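(* Let $K$ be a quadratic number field and let $E$ be an elliptic curve over $K$ such that the group $E(K)$ contains a subgroup isomorphic to $C_{16}=\mathbb{Z}/16\mathbb{Z}$. Then $E$ is a base change of an elliptic curve over $\mathbb{Q}$, i.e. there exists an elliptic curve $E_0$ over $\mathbb{Q}$ such that $E_0\times_{\mathbb{Q}}K\cong E$ over $K$. *)

(* Defs.v *)
(* Elliptic curves in (long) Weierstrass form, following
   Silverman, "The Arithmetic of Elliptic Curves", Ch. III. *)
From HB Require Import structures.
From mathcomp Require Import all_boot all_order all_algebra all_field.
Set Implicit Arguments. Unset Strict Implicit. Unset Printing Implicit Defensive.
Import GRing.Theory.
Local Open Scope ring_scope.

(* Coefficients [a1; a2; a3; a4; a6] of y^2 + a1 x y + a3 y = x^3 + a2 x^2 + a4 x + a6 *)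
Record wcoeffs (R : Type) := WCoeffs { a1 : R; a2 : R; a3 : R; a4 : R; a6 : R }.

Section Weierstrass.
Variable F : fieldType.
Implicit Types (E : wcoeffs F).

Definition wb2 E := a1 E ^+ 2 + 4%:R * a2 E.
Definition wb4 E := 2%:R * a4 E + a1 E * a3 E.
Definition wb6 E := a3 E ^+ 2 + 4%:R * a6 E.
Definition wb8 E := a1 E ^+ 2 * a6 E + 4%:R * a2 E * a6 E - a1 E * a3 E * a4 E
                    + a2 E * a3 E ^+ 2 - a4 E ^+ 2.
Definition wdisc E := - wb2 E ^+ 2 * wb8 E - 8%:R * wb4 E ^+ 3 - 27%:R * wb6 E ^+ 2
                      + 9%:R * wb2 E * wb4 E * wb6 E.

Definition elliptic E := wdisc E != 0.

(* Points: None is the point at infinity O, Some (x, y) an affine point. *)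
Definition wpoint := option (F * F).

Definition on_curve E (P : wpoint) : bool :=
  match P with
  | None => true
  | Some (x, y) => y ^+ 2 + a1 E * x * y + a3 E * y
                   == x ^+ 3 + a2 E * x ^+ 2 + a4 E * x + a6 E
  end.

(* The chord-tangent group law (Silverman III.2.3). *)
Definition wadd E (P Q : wpoint) : wpoint :=
  match P, Q with
  | None, _ => Q
  | _, None => P
  | Some (x1, y1), Some (x2, y2) =>
    if (x1 == x2) && (y1 + y2 + a1 E * x2 + a3 E == 0) then None else
    let '(lam, nu) :=
      if x1 != x2 then
        ((y2 - y1) / (x2 - x1), (y1 * x2 - y2 * x1) / (x2 - x1))
      else
        ((3%:R * x1 ^+ 2 + 2%:R * a2 E * x1 + a4 E - a1 E * y1)
           / (2%:R * y1 + a1 E * x1 + a3 E),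
         (- x1 ^+ 3 + a4 E * x1 + 2%:R * a6 E - a3 E * y1)
           / (2%:R * y1 + a1 E * x1 + a3 E)) in
    let x3 := lam ^+ 2 + a1 E * lam - a2 E - x1 - x2 in
    Some (x3, - (lam + a1 E) * x3 - nu - a3 E)
  end.

Definition wmul E (n : nat) (P : wpoint) : wpoint := iter n (wadd E P) None.

Definition has_order E (P : wpoint) (n : nat) : Prop :=
  wmul E n P = None /\ forall m, (0 < m < n)%N -> wmul E m P <> None.

(* E(F) contains a subgroup isomorphic to Z/nZ, i.e. a point of exact order n
   (the cyclic subgroup it generates). *)
Definition has_cyclic_subgroup E (n : nat) : Prop :=
  exists P : wpoint, on_curve E P /\ has_order E P n.

(* Isomorphism of Weierstrass equations over F (Silverman III.1, Table 3.1):
   E' is obtained from E by x = u^2 x' + r, y = u^3 y' + s u^2 x' + t, u <> 0. *)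
Definition wiso E E' : Prop :=
  exists u r s t : F, u != 0 /\
    u * a1 E' = a1 E + 2%:R * s /\
    u ^+ 2 * a2 E' = a2 E - s * a1 E + 3%:R * r - s ^+ 2 /\
    u ^+ 3 * a3 E' = a3 E + r * a1 E + 2%:R * t /\
    u ^+ 4 * a4 E' = a4 E - s * a3 E + 2%:R * r * a2 E - (t + r * s) * a1 E
                     + 3%:R * r ^+ 2 - 2%:R * s * t /\
    u ^+ 6 * a6 E' = a6 E + r * a4 E + r ^+ 2 * a2 E + r ^+ 3 - t * a3 E
                     - t ^+ 2 - r * t * a1 E.
End Weierstrass.

Definition wbase_change (K : fieldExtType rat) (E0 : wcoeffs rat) : wcoeffs K :=
  WCoeffs (a1 E0)%:A (a2 E0)%:A (a3 E0)%:A (a4 E0)%:A (a6 E0)%:A.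

(* Main.v *)
(** Halving the point of order 2 three times puts a curve with a point of order 16, over a field
    of characteristic not 2, in the form
      [y^2 = x^3 + ((h^2 - 1)^4 - 8 h^4) x^2 + 16 h^8 x],
    where [(h^2 - 1) (h^2 + 1) (h^2 + 2 h - 1)] is a square.  If [h] is rational we are done.
    Otherwise [h = (1 - x) / (1 + x)] yields a point with irrational [x] on the genus two curve
      [C : y^2 = x (x^2 + 1) (x^2 + 2 x - 1)],
    a model of [X_1(16)], and [x^2 + 1 = 0] or [x^2 + 2 x - 1 = 0] because the Jacobian [J] of
    [C] has only 20 rational points; both cases make the elliptic curve singular.

    The finiteness of [J(Q)] is proved by descent.  The automorphism [(x, y) |-> (-1/x, y/x^3)]
    makes [J] a module over [Z[i]], and the kernel of [phi = 1 + i] consists of the four rational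
    points of order dividing 2.  Square classes unramified outside 2, with an obstruction at 2,
    show that [J(Q) = phi J(Q) + J[phi]].  On the Kummer surface of [J], [phi] is given by
    quadratic forms and translation by [J[phi]] by linear ones, and [height(phi P)] grows like
    [height(P)^2]; so everything comes from points of height at most 128, which are enumerated. *)

(* An irrational [x] and its conjugate form a rational degree two divisor, hence a rational point of
   [J]; only its minimal polynomial [x^2 + b x + c] has to be pinned down, so the argument can live
   on the Kummer surface, where the group law of [J] is replaced by identities between four
   coordinates. The price is that this surface has many rational points which come from quadratic
   twists of [J] only. Every step therefore carries the two square conditions of [liftable], and the
   hardest identities show that these pass to preimages under [phi]. Using [phi] instead of doubling
   keeps the maps quadratic and the kernel rational. The bound 128 is 4 * 16 * 2: a factor 4 is lost
   in comparing [height(P)^2] with [height(phi P)], the coordinates of [phi P] may share a factor up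
   to 4, and a translation by 2-torsion may double the height. On the elliptic side associativity is
   never proved; the few multiples of the point that matter are computed in Tate's normal form. *)
Require Import Defs.
From HB Require Import structures.
From mathcomp Require Import all_boot all_order all_algebra all_field.
From Stdlib Require Import ZArith Znumtheory Lia Classical.
Set Implicit Arguments. Unset Strict Implicit. Unset Printing Implicit Defensive.
Import GRing.Theory Num.Theory.

(** * Squares and square-free parts of integers *)

Section IntegerSquares.
Local Open Scope Z_scope.

Definition is_square (m : Z) : Prop := exists a, m = a * a.

Lemma coprime_parts (a b : Z) : a <> 0 ->
  exists g a' b', g <> 0 /\ a = a' * g /\ b = b' * g /\ rel_prime a' b'.
Proof.
move=> a0; have [a' ha] := Z.gcd_divide_l a b; have [b' hb] := Z.gcd_divide_r a b.
have g0 : Z.gcd a b <> 0 by move/Z.gcd_eq_0_l.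
exists (Z.gcd a b), a', b'; do 3 (split=> //).
apply/Zgcd_1_rel_prime; apply: (Z.mul_reg_r _ _ (Z.gcd a b)) => //.
have {1}-> : Z.gcd a b = Z.abs (Z.gcd a b) by rewrite Z.abs_eq //; exact: Z.gcd_nonneg.
by rewrite -Z.gcd_mul_mono_r -ha -hb Z.mul_1_l.
Qed.

Lemma is_square_of_mul_square (a m : Z) :
  a <> 0 -> is_square (a * a * m) -> is_square m.
Proof.
move=> a0 [b hb].
have [g [a' [b' [g0 [ha [hb' cop]]]]]] := coprime_parts b a0.
have e : a' * (a' * m) = b' * b'.
  by apply: (Z.mul_reg_l _ _ (g * g)); [nia | subst; lia].
have d1 : Z.divide a' b'.
  by apply: (Gauss a' b' b') => //; exists (a' * m); lia.
have u : Z.divide a' 1.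
  by have [_ _ h] := cop; apply: h => //; apply: Z.divide_refl.
have : a' = 1 \/ a' = -1 by apply: Z.divide_1_r.
by case=> e1; exists b'; rewrite -e e1; lia.
Qed.

Lemma is_square_mul (m x : Z) : is_square m -> is_square x -> is_square (m * x).
Proof. by case=> a -> [b ->]; exists (a * b); lia. Qed.

Definition squarefree (f : Z) : Prop := forall p, prime p -> ~ Z.divide (p * p) f.

Lemma squarefree_decomposition (m : Z) : m <> 0 ->
  exists f r, m = f * (r * r) /\ f <> 0 /\ r <> 0 /\ squarefree f.
Proof.
have [N] : exists N, Z.abs m < Z.of_nat N by exists (S (Z.abs_nat m)); lia.
elim: N m => [|N IH] m hN m0; first lia.
have [[p [pp [q hq]]]|none] := classic (exists p, prime p /\ Z.divide (p * p) m).
  have p1 : 1 < p by case: pp.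
  have q0 : q <> 0 by nia.
  have [|f [r [e [f0 [r0 sf]]]]] := IH q _ q0.
    have : Z.abs m = Z.abs q * (p * p) by rewrite hq Z.abs_mul (Z.abs_eq (p * p)); nia.
    have : 4 <= p * p by nia.
    have : 1 <= Z.abs q by lia.
    by move: hN; rewrite Nat2Z.inj_succ; nia.
  exists f, (r * p); split; first by rewrite hq e; ring.
  by split=> //; split=> //; nia.
exists m, 1; split; first lia.
by do 2 (split=> //); move=> p pp d; apply: none; exists p.
Qed.

Lemma prime_divisor_exists (m : Z) : m <> 0 -> Z.abs m <> 1 ->
  exists p, prime p /\ Z.divide p m.
Proof.
have [N] : exists N, Z.abs m < Z.of_nat N by exists (S (Z.abs_nat m)); lia.
elim: N m => [|N IH] m hN m0 m1; first lia.
have [pp|np] := prime_dec (Z.abs m).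
  by exists (Z.abs m); split=> //; apply/Z.divide_abs_l/Z.divide_refl.
have [|q [hq /Z.divide_abs_r dq]] := not_prime_divide _ _ np; first lia.
have [|||p [pp dp]] := IH q; try lia.
by exists p; split=> //; apply: Z.divide_trans dq.
Qed.

(** The prime divides [f] exactly once and a square to an even power, so the missing factor comes
    from [x]. *)
Lemma prime_divides_of_square (p f x : Z) :
  prime p -> squarefree f -> Z.divide p f -> is_square (f * x) -> Z.divide p x.
Proof.
move=> pp sf pf [y e].
have p0 : 1 < p by case: pp.
have [f' ef] := pf.
have py : Z.divide p y.
  have : Z.divide p (y * y) by rewrite -e; apply: Z.divide_mul_l.
  by case/(prime_mult _ pp).
have [y' ey] := py.
have : Z.divide p (f' * x) by exists (y' * y'); nia.
case/(prime_mult _ pp) => // -[g eg].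
by case: (sf p pp); exists g; subst; lia.
Qed.

Lemma prime_divides_square (p x : Z) : prime p -> Z.divide p (x * x) -> Z.divide p x.
Proof. by move=> pp /(prime_mult _ pp); case. Qed.

Lemma odd_prime_not_divide_pow2 (p : Z) : prime p -> p <> 2 -> ~ Z.divide p 2.
Proof.
move=> pp p2 /(prime_div_prime _ _ pp prime_2); exact: p2.
Qed.

Lemma odd_prime_cancel2 (p x : Z) : prime p -> p <> 2 -> Z.divide p (2 * x) -> Z.divide p x.
Proof.
by move=> pp p2 /(prime_mult _ pp) [/(odd_prime_not_divide_pow2 pp p2)|].
Qed.

Lemma squarefree_no_odd_prime (f : Z) : f <> 0 -> squarefree f ->
  (forall p, prime p -> p <> 2 -> ~ Z.divide p f) ->
  f = 1 \/ f = -1 \/ f = 2 \/ f = -2.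
Proof.
move=> f0 sf no.
have odd1 g : g <> 0 -> Z.divide g f -> ~ Z.divide 2 g -> g = 1 \/ g = -1.
  move=> g0 gf g2.
  have [|n1] := classic (Z.abs g = 1); first lia.
  have [p [pp pg]] := prime_divisor_exists g0 n1.
  case: (classic (p = 2)) => [e|ne]; first by case: g2; rewrite -e.
  by case: (no p pp ne); apply: Z.divide_trans gf.
have [[g eg]|n2] := classic (Z.divide 2 f); last first.
  by have := odd1 f f0 (Z.divide_refl f) n2; tauto.
have gf : Z.divide g f by exists 2; lia.
have g2 : ~ Z.divide 2 g by case=> h eh; apply: (sf 2 prime_2); exists h; lia.
by have := odd1 g _ gf g2; lia.
Qed.

End IntegerSquares.

(** * Descent on the Kummer surface *)

Section KummerDescent.
Local Open Scope Z_scope.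

(* For a degree two divisor cut out on the curve by [x^2 + b x + c], put [n = 1 + c],
   [e = 1 - c], [d = 1 - c - b]: then [n^2 - e^2], [vnorm d e] and [2 n^2 - d^2] are, up to
   squares, the norms of [x], [x^2 + 1] and [x^2 + 2 x - 1].  The fourth coordinate [k] turns
   [(n : k : d : e)] into the point of the Kummer quartic of the Jacobian. *)
Definition vnorm (d e : Z) : Z := e * e + (e - d) * (e - d).

Definition kummer (n k d e : Z) : Prop :=
  vnorm d e * (n * n + (n - k) * (n - k)) = (n * k - e * d) * (n * k - e * d).

(* The two functions are squares exactly when the point of the Kummer surface comes from the
   Jacobian itself rather than from a quadratic twist of it. *)
Definition liftable (n k d e : Z) : Prop :=
  kummer n k d e /\ is_square (2 * (n - e) * (k - d) * vnorm d e) /\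
  is_square (2 * (n + e) * (k + d) * vnorm d e).

Definition primitive (n k d e : Z) : Prop := forall p, prime p ->
  ~ (Z.divide p n /\ Z.divide p k /\ Z.divide p d /\ Z.divide p e).

(* The four points of the Kummer surface coming from rational 2-torsion. *)
Definition axial (n k d e : Z) : Prop :=
  (k = 0 /\ d = 0 /\ e = 0) \/ (n = 0 /\ d = 0 /\ e = 0) \/
  (n = 0 /\ k = 0 /\ e = 0) \/ (n = 0 /\ k = 0 /\ d = 0).

(** * Identities on the Kummer quartic *)

Lemma kummer_square1 n k d e : kummer n k d e ->
  is_square ((n * n - e * e) * (k * k - d * d)).
Proof.
rewrite /kummer /vnorm => h; exists (k * (e - d) - n * (2 * e - d)); lia.
Qed.

Lemma kummer_square2 n k d e : kummer n k d e ->
  is_square ((2 * n * n - d * d) * (k * k - 2 * e * e)).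
Proof.
rewrite /kummer /vnorm => h; exists (k * (2 * e - d) - 2 * n * (e - d)); lia.
Qed.

(** This reflects that the product of the norms of [x], [x^2 + 1] and [x^2 + 2 x - 1] is the square
    of the norm of [y]. *)
Lemma kummer_square3 n k d e : kummer n k d e ->
  (n * n - e * e) * vnorm d e * (2 * n * n - d * d) =
  (k * (vnorm d e - n * n) - n * (e - d) * (2 * e - d)) *
  (k * (vnorm d e - n * n) - n * (e - d) * (2 * e - d)).
Proof.
rewrite /kummer /vnorm => h.
have := f_equal (fun z => (e * e + (e - d) * (e - d) - n * n) * z) h; lia.
Qed.

Lemma kummer_square4 n k d e : kummer n k d e ->
  (n * k + e * d) * (n * k + e * d) = (n * d + k * e) * (n * d + k * e) +
  (2 * n * e + k * d - n * d - k * e) * (2 * n * e + k * d - n * d - k * e).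
Proof. rewrite /kummer /vnorm => h; lia. Qed.

Lemma twice_square_neq (x y : Z) : x <> 0 -> 2 * x * x <> y * y.
Proof.
move=> x0 h.
have : is_square 2 by apply: (is_square_of_mul_square x0); exists y; lia.
by case=> a ha; have : a = -1 \/ a = 0 \/ a = 1 \/ 2 <= Z.abs a by [lia]; nia.
Qed.

Lemma vnorm_eq0 d e : vnorm d e = 0 -> d = 0 /\ e = 0.
Proof. by rewrite /vnorm => h; have : e = 0 /\ e - d = 0 by [nia]; lia. Qed.

Lemma kummer_vnorm_neq0 n k d e : kummer n k d e -> ~ axial n k d e -> vnorm d e <> 0.
Proof.
move=> h na /vnorm_eq0 [d0 e0]; apply: na.
move: h; rewrite /kummer /vnorm d0 e0 => h.
by have : n = 0 \/ k = 0 by [nia]; rewrite /axial; lia.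
Qed.

Lemma kummer_2nn_neq_dd n k d e : kummer n k d e -> ~ axial n k d e ->
  2 * n * n <> d * d.
Proof.
move=> h na h2; have [n0|n0] := classic (n = 0); last exact: (twice_square_neq n0 h2).
have d0 : d = 0 by nia.
apply: na; move: h; rewrite /kummer /vnorm n0 d0 => h.
by have : e = 0 \/ k = 0 by [nia]; rewrite /axial; lia.
Qed.

#[local] Hint Resolve Z.divide_add_r Z.divide_sub_r Z.divide_mul_r : zdiv.

Lemma prime_not_primitive p n k d e : primitive n k d e -> prime p ->
  Z.divide p n -> Z.divide p k -> Z.divide p d -> Z.divide p e -> False.
Proof. by move=> h pp pn pk pd pe; apply: (h p pp). Qed.

Lemma prime_divides_vnorm p d e : prime p -> p <> 2 ->
  Z.divide p (vnorm d e) -> Z.divide p (d * e) -> Z.divide p d /\ Z.divide p e.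
Proof.
move=> pp p2 pv pde.
have [pd|pe] := prime_mult _ pp _ _ pde; split=> //.
  apply/(prime_divides_square pp)/(odd_prime_cancel2 pp p2).
  have -> : 2 * (e * e) = vnorm d e - (d - 2 * e) * d by rewrite /vnorm; ring.
  by auto with zdiv.
apply: (prime_divides_square pp).
have -> : d * d = vnorm d e - (2 * e - 2 * d) * e by rewrite /vnorm; ring.
by auto with zdiv.
Qed.

(** An odd prime in the square-free part of [vnorm d e] divides every function whose product with
    [vnorm d e] is a square: both functions of [liftable] and the cofactor in the Kummer equation.
    Sums and differences of these then make it divide all coordinates. The sign is settled because
    [vnorm] is a sum of two squares. *)
Lemma vnorm_square_class n k d e : liftable n k d e -> primitive n k d e ->
  ~ axial n k d e ->
  exists tau s, (tau = 1 \/ tau = 2) /\ s <> 0 /\ vnorm d e = tau * (s * s).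
Proof.
move=> [h [h1 h2]] prim na.
have v0 := kummer_vnorm_neq0 h na.
have [f [s [ev [f0 [s0 sf]]]]] := squarefree_decomposition v0.
have vpos : 0 <= vnorm d e by rewrite /vnorm; nia.
suff : f = 1 \/ f = -1 \/ f = 2 \/ f = -2.
  by move=> hf; exists f, s; split; [nia | split].
apply: squarefree_no_odd_prime => // p pp p2 pf.
have strip x : is_square (x * vnorm d e) -> Z.divide p x.
  rewrite ev => hx; apply: (prime_divides_of_square pp sf pf).
  by apply: (is_square_of_mul_square s0); move: hx; congr is_square; ring.
have pv : Z.divide p (vnorm d e) by rewrite ev; apply: Z.divide_mul_l.
have pu : Z.divide p (n * n + (n - k) * (n - k)).
  by apply: strip; rewrite Z.mul_comm h; exists (n * k - e * d).
have pl : Z.divide p (n * k - e * d).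
  by apply: (prime_divides_square pp); rewrite -h; apply: Z.divide_mul_l.
have p1 := strip _ h1; have p3 := strip _ h2.
have prho : Z.divide p (n * k + e * d).
  apply/(odd_prime_cancel2 pp p2)/(odd_prime_cancel2 pp p2).
  have -> : 2 * (2 * (n * k + e * d)) = 2 * (n - e) * (k - d) + 2 * (n + e) * (k + d) by ring.
  by auto with zdiv.
have pD : Z.divide p (n * d + k * e).
  apply/(odd_prime_cancel2 pp p2)/(odd_prime_cancel2 pp p2).
  have -> : 2 * (2 * (n * d + k * e)) = 2 * (n + e) * (k + d) - 2 * (n - e) * (k - d) by ring.
  by auto with zdiv.
have pE : Z.divide p (2 * n * e + k * d - n * d - k * e).
  apply: (prime_divides_square pp).
  have := kummer_square4 h; set x := _ * _ => hx.
  set y := (2 * n * e + _ - _ - _).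
  have -> : y * y = (n * k + e * d) * (n * k + e * d) - (n * d + k * e) * (n * d + k * e).
    by rewrite /y; move: hx; rewrite /x; lia.
  by auto with zdiv.
have pC : Z.divide p (2 * n * e + k * d).
  have -> : 2 * n * e + k * d = 2 * n * e + k * d - n * d - k * e + (n * d + k * e) by ring.
  by auto with zdiv.
have pnk : Z.divide p (n * k).
  apply: (odd_prime_cancel2 pp p2).
  have -> : 2 * (n * k) = n * k + e * d + (n * k - e * d) by ring.
  by auto with zdiv.
have ped : Z.divide p (d * e).
  have -> : d * e = n * k + e * d - n * k by ring.
  by auto with zdiv.
have [pd pe] := prime_divides_vnorm pp p2 pv ped.
have [pn|pk] := prime_mult _ pp _ _ pnk.
  apply: (prime_not_primitive prim pp) => //.
  apply: (prime_divides_square pp).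
  have -> : k * k = n * n + (n - k) * (n - k) - (2 * n - 2 * k) * n by ring.
  by auto with zdiv.
apply: (prime_not_primitive prim pp) => //.
apply/(prime_divides_square pp)/(odd_prime_cancel2 pp p2).
have -> : 2 * (n * n) = n * n + (n - k) * (n - k) - (k - 2 * n) * k by ring.
by auto with zdiv.
Qed.

Lemma opposite_liftable n k d e : liftable n k d e -> liftable n k (- d) (- e).
Proof.
rewrite /liftable /kummer /vnorm => -[h [h1 h2]]; split; first lia.
by split; [move: h2 | move: h1]; congr is_square; ring.
Qed.

(* [f] is the square-free part of [n^2 - e^2]: an odd prime dividing it divides
   [2 n^2 - d^2], [k^2 - d^2] and [k^2 - 2 e^2] as well, which fixes [d/n], [k/n], [e/n] modulo
   [p] up to signs, and liftability rules out every choice of signs. *)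
Section OddPrimes.
Variables (n k d e tau s f r p : Z).
Hypotheses (good : liftable n k d e) (prim : primitive n k d e).
Hypotheses (tau12 : tau = 1 \/ tau = 2) (s0 : s <> 0) (ev : vnorm d e = tau * (s * s)).
Hypotheses (ef : n * n - e * e = f * (r * r)) (f0 : f <> 0) (r0 : r <> 0).
Hypothesis m0 : 2 * n * n <> d * d.

Lemma class_relation3 : is_square (f * (tau * (2 * n * n - d * d))).
Proof.
apply: (is_square_of_mul_square (a := r * s)); first nia.
have [h _] := good.
have : is_square ((n * n - e * e) * vnorm d e * (2 * n * n - d * d)).
  by rewrite (kummer_square3 h); eexists.
by rewrite ef ev; congr is_square; ring.
Qed.

Lemma class_relation1 : is_square (f * (k * k - d * d)).
Proof.
apply: (is_square_of_mul_square r0); have [h _] := good.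
by move: (kummer_square1 h); rewrite ef; congr is_square; ring.
Qed.

Lemma class_relation2 : is_square (f * (tau * (k * k - 2 * e * e))).
Proof.
apply: (is_square_of_mul_square (a := 2 * n * n - d * d)); first lia.
have [h _] := good.
have := is_square_mul class_relation3 (kummer_square2 h).
by congr is_square; ring.
Qed.

Hypotheses (sf : squarefree f) (pp : prime p) (p2 : p <> 2) (pf : Z.divide p f).

Lemma odd_prime_cancel_tau x : Z.divide p (tau * x) -> Z.divide p x.
Proof.
case: tau12 => ->; last exact: odd_prime_cancel2.
by rewrite Z.mul_1_l.
Qed.

(** The prime divides neither [n] nor [k - d], while the first function of [liftable] times
    [n^2 - e^2] makes it divide [(k - d) (n + e)], hence [2 n]. The case of a prime dividing [n + e]
    reduces to this one by [opposite_liftable]. *)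
Lemma class_prime_not_divides_sub : Z.divide p (n - e) -> False.
Proof.
move=> pne; have [h [h1 _]] := good.
have pm := odd_prime_cancel_tau (prime_divides_of_square pp sf pf class_relation3).
have pk2 := odd_prime_cancel_tau (prime_divides_of_square pp sf pf class_relation2).
have pkd := prime_divides_of_square pp sf pf class_relation1.
have pn : ~ Z.divide p n.
  move=> pn.
  have pe : Z.divide p e by have -> : e = n - (n - e) by [ring]; auto with zdiv.
  have pd : Z.divide p d.
    apply: (prime_divides_square pp).
    have -> : d * d = 2 * n * n - (2 * n * n - d * d) by ring.
    by auto with zdiv.
  apply: (prime_not_primitive prim pp) => //; apply: (prime_divides_square pp).
  have -> : k * k = k * k - d * d + d * d by ring.
  by auto with zdiv.
have nk : ~ Z.divide p (k - d).
  move=> pk.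
  have : Z.divide p (vnorm d e * (n * n + (n - k) * (n - k))).
    rewrite h; apply: Z.divide_mul_l.
    have -> : n * k - e * d = n * (k - d) + d * (n - e) by ring.
    by auto with zdiv.
  have pn4 : Z.divide p (2 * (n * (2 * n - d))) -> False.
    move/(odd_prime_cancel2 pp p2)/(prime_mult _ pp) => [//|p2nd].
    apply: pn; apply/(prime_divides_square pp)/(odd_prime_cancel2 pp p2).
    have -> : 2 * (n * n) = (2 * n + d) * (2 * n - d) - (2 * n * n - d * d) by ring.
    by auto with zdiv.
  case/(prime_mult _ pp) => hp; apply: pn4.
    have -> : 2 * (n * (2 * n - d)) =
      vnorm d e + (2 * n * n - d * d) + (2 * n + 2 * e - 2 * d) * (n - e).
      by rewrite /vnorm; ring.
    by auto with zdiv.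
  have -> : 2 * (n * (2 * n - d)) = n * n + (n - k) * (n - k) + (2 * n * n - d * d)
    + (2 * n - k - d) * (k - d) by ring.
  by auto with zdiv.
have ne0 : n - e <> 0 by move=> x0; move: ef; have -> : n = e by [lia]; nia.
have : is_square (f * (2 * tau * (k - d) * (n + e))).
  apply: (is_square_of_mul_square (a := s * (n - e))); first nia.
  have sqf : is_square ((n - e) * (n + e) * f).
    by exists (f * r); have -> : (n - e) * (n + e) = n * n - e * e by [ring]; rewrite ef; ring.
  by have := is_square_mul h1 sqf; rewrite ev; congr is_square; ring.
move/(prime_divides_of_square pp sf pf); rewrite -!Z.mul_assoc.
move/(odd_prime_cancel2 pp p2)/odd_prime_cancel_tau/(prime_mult _ pp) => [//|pne'].
apply: pn; apply: (odd_prime_cancel2 pp p2).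
have -> : 2 * n = n - e + (n + e) by ring.
by auto with zdiv.
Qed.

End OddPrimes.

(* The 2-adic obstruction. *)
Lemma no_even_class n k d e sg tau r s : liftable n k d e -> primitive n k d e ->
  sg = 1 \/ sg = -1 -> tau = 1 \/ tau = 2 ->
  r <> 0 -> s <> 0 -> 2 * n * n <> d * d ->
  vnorm d e = tau * (s * s) -> n * n - e * e = 2 * sg * (r * r) -> False.
Proof.
move=> good prim hsg htau r0 s0 m0 ev ef.
have sg0 : 2 * sg <> 0 by lia.
have [c hc] := class_relation1 good ef r0.
have [b hb] := class_relation3 good s0 ev ef r0.
have even_half x y : 2 * x = y * y -> exists z, y = 2 * z.
  move=> hxy; have [z [hz|hz]] : exists z, y = 2 * z \/ y = 2 * z + 1.
    by case: (Z.Even_or_Odd y) => -[z hz]; exists z; lia.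
    by exists z.
  by exfalso; move: hxy; rewrite hz; lia.
have [c' hc'] := even_half (sg * (k * k - d * d)) c ltac:(lia).
have [b' hb'] := even_half (sg * (tau * (2 * n * n - d * d))) b ltac:(lia).
subst c b.
have hkd : k * k - d * d = 2 * sg * (c' * c') by nia.
have hm : tau * (2 * n * n - d * d) = 2 * sg * (b' * b') by nia.
have np := prim 2 prime_2.
have half x : exists y, x = 2 * y \/ x = 2 * y + 1.
  by case: (Z.Even_or_Odd x) => -[y hy]; exists y; lia.
have [n' hn] := half n; have [k' hk] := half k.
have [d' hd] := half d; have [e' he] := half e.
have [s' hs] := half s; have [b'' hb''] := half b'.
have ediv x y : x = 2 * y -> Z.divide 2 x by exists y; lia.
rewrite /vnorm in ev.
have ne : n = 2 * n' /\ e = 2 * e' \/ n = 2 * n' + 1 /\ e = 2 * e' + 1.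
  case: hn => hn; case: he => he; [by left | exfalso | exfalso | by right];
  by move: ef; rewrite hn he; lia.
have kd : k = 2 * k' /\ d = 2 * d' \/ k = 2 * k' + 1 /\ d = 2 * d' + 1.
  case: hk => hk; case: hd => hd; [by left | exfalso | exfalso | by right];
  by move: hkd; rewrite hk hd; lia.
clear - ev hm ediv np htau hsg ne kd hs hb''.
(* All even contradicts primitivity. When [d] is odd, [vnorm d e] and [2 n^2 - d^2] are odd, against
   [ev] if [tau = 2] and [hm] if [tau = 1]. When only [n] and [e] are odd, both are 2 modulo 4,
   which a square up to sign never is. *)
case: ne => -[hn he]; case: kd => -[hk hd].
- by apply: np; split; [|split; [|split]]; apply: ediv; eassumption.
- by rewrite he hd in ev; rewrite hn hd in hm; case: htau => ht; rewrite ht in ev hm; lia.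
- rewrite he hd in ev; rewrite hn hd in hm; case: htau => ht; rewrite ht in ev hm.
    by case: hs => hs; rewrite hs in ev; lia.
  by case: hb'' => hb; rewrite hb in hm; case: hsg => hg; rewrite hg in hm; lia.
- by rewrite he hd in ev; rewrite hn hd in hm; case: htau => ht; rewrite ht in ev hm; lia.
Qed.

(** The third class is the product of the other two by [kummer_square3], which leaves four classes,
    as many as there are translations. *)
Lemma class_unit n k d e : liftable n k d e -> primitive n k d e ->
  ~ axial n k d e -> n * n <> e * e ->
  exists sg tau r s t, (sg = 1 \/ sg = -1) /\ (tau = 1 \/ tau = 2) /\
    n * n - e * e = sg * (r * r) /\ vnorm d e = tau * (s * s) /\
    2 * n * n - d * d = sg * tau * (t * t).
Proof.
move=> good prim na ne0.
have [h _] := good.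
have m0 := kummer_2nn_neq_dd h na.
have [tau [s [htau [s0 ev]]]] := vnorm_square_class good prim na.
have [f [r [ef [f0 [r0 sf]]]]] : exists f r, n * n - e * e = f * (r * r) /\
    f <> 0 /\ r <> 0 /\ squarefree f by apply: squarefree_decomposition; lia.
have hf : f = 1 \/ f = -1 \/ f = 2 \/ f = -2.
  apply: squarefree_no_odd_prime => // p pp p2 pf.
  have : Z.divide p (r * r * f) by auto with zdiv.
  have -> : r * r * f = (n - e) * (n - - e) by lia.
  case/(prime_mult _ pp).
    exact: (class_prime_not_divides_sub good prim htau s0 ev ef f0 r0 m0 sf pp p2 pf).
  apply: (class_prime_not_divides_sub (opposite_liftable good) (tau := tau) (s := s)
    (f := f) (r := r) _ htau s0 _ _ f0 r0 _ sf pp p2 pf); try lia.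
    move=> q qq [qn [qk [/Z.divide_opp_r qd /Z.divide_opp_r qe]]].
    by apply: (prim q qq).
  by rewrite -ev /vnorm; ring.
have hsg : f = 1 \/ f = -1.
  have no g := @no_even_class n k d e g tau r s good prim.
  case: hf => [->|[->|[e2|e2]]]; [by left | by right | exfalso | exfalso].
    by apply: (no 1) => //; [left | lia].
  by apply: (no (-1)) => //; [right | lia].
have [t ht] : exists t, 2 * n * n - d * d = f * tau * (t * t).
  have [c hc] := class_relation3 good s0 ev ef r0.
  case: htau => ht; rewrite ht in hc |- *.
    by exists c; case: hsg => hg; rewrite hg in hc |- *; lia.
  have [c' ec] : exists c', c = 2 * c'.
    by case: (Z.Even_or_Odd c) => -[c' ec]; exists c'; rewrite ec in hc; lia.
  by exists c'; rewrite ec in hc; case: hsg => hg; rewrite hg in hc |- *; lia.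
by exists f, tau, r, s, t.
Qed.

(** * Translation by rational 2-torsion *)

Definition all_square (n k d e : Z) : Prop :=
  is_square (n * n - e * e) /\ is_square (vnorm d e) /\ is_square (2 * n * n - d * d).

Lemma liftable_translate1 n k d e : liftable n k d e -> liftable k (2 * n) (2 * e) d.
Proof.
rewrite /liftable /kummer /vnorm => -[h [h1 h2]]; split; first lia.
by split; [case: h1 => a ha | case: h2 => a ha]; exists (2 * a); lia.
Qed.

(** The Kummer equation puts [vnorm d e] and its translate [n^2 + (n - k)^2] in the same square
    class, so one may replace the other. *)
Lemma liftable_dual n k d e : liftable n k d e -> vnorm d e <> 0 ->
  is_square (2 * (n - e) * (k - d) * (n * n + (n - k) * (n - k))) /\
  is_square (2 * (n + e) * (k + d) * (n * n + (n - k) * (n - k))).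
Proof.
move=> [h [h1 h2]] v0.
have sq : is_square (vnorm d e * (n * n + (n - k) * (n - k))) by eexists; exact: h.
by split; apply: (is_square_of_mul_square v0);
  [have := is_square_mul h1 sq | have := is_square_mul h2 sq]; congr is_square; ring.
Qed.

Lemma liftable_translate3 n k d e : liftable n k d e -> vnorm d e <> 0 ->
  liftable (- e) (- d) k n.
Proof.
move=> g v0; have [h1 h2] := liftable_dual g v0; have [h _] := g.
split; first by move: h; rewrite /kummer /vnorm; lia.
by split; [move: h2 | move: h1]; congr is_square; rewrite /vnorm; ring.
Qed.

Lemma liftable_scale c n k d e : c <> 0 ->
  liftable (c * n) (c * k) (c * d) (c * e) -> liftable n k d e.
Proof.
rewrite /liftable /kummer /vnorm => c0 [h [h1 h2]]; split.
  have c2 : c * c <> 0 by nia.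
  by apply: (Z.mul_reg_l _ _ (c * c * (c * c))); [nia | lia].
by split; apply: (is_square_of_mul_square (a := c * c)); try nia;
  [move: h1 | move: h2]; congr is_square; ring.
Qed.

Lemma all_square_scale c n k d e : c <> 0 ->
  all_square (c * n) (c * k) (c * d) (c * e) -> all_square n k d e.
Proof.
rewrite /all_square /vnorm => c0 [h1 [h2 h3]].
by split; [|split]; apply: (is_square_of_mul_square c0);
  [move: h1 | move: h2 | move: h3]; congr is_square; ring.
Qed.

Lemma all_square_unscale c n k d e :
  all_square n k d e -> all_square (c * n) (c * k) (c * d) (c * e).
Proof.
move=> [h1 [h2 h3]]; have cc : is_square (c * c) by exists c.
by split; [|split];
  [move: (is_square_mul cc h1) | move: (is_square_mul cc h2) | move: (is_square_mul cc h3)];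
  congr is_square; rewrite /vnorm; ring.
Qed.

(* Translations by the rational 2-torsion points are linear on the Kummer surface, with these
   matrices up to scaling; they permute the classes [(sg, tau)] simply transitively. *)
Definition some_translate (P : Z -> Z -> Z -> Z -> Prop) (n k d e : Z) : Prop :=
  P n k d e \/ P k (2 * n) (2 * e) d \/ P (- d) (2 * - e) (2 * n) k \/ P (- e) (- d) k n.

Lemma all_square_translate_generic n k d e : liftable n k d e -> primitive n k d e ->
  ~ axial n k d e -> n * n <> e * e -> some_translate all_square n k d e.
Proof.
move=> g prim na ne.
have [sg [tau [r [s [t [hsg [htau [er [es et]]]]]]]]] := class_unit g prim na ne.
have [h _] := g; have v0 := kummer_vnorm_neq0 h na.
have m0 := kummer_2nn_neq_dd h na.
have q1 := kummer_square1 h; have q2 := kummer_square2 h.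
have q3 : is_square (vnorm d e * (n * n + (n - k) * (n - k))) by eexists; exact: h.
have r0 : r <> 0 by nia.
have s0 : s <> 0 by nia.
have t0 : t <> 0 by nia.
rewrite er in q1; rewrite es in q3; rewrite et in q2.
have p1 : is_square (sg * (k * k - d * d)).
  by apply: (is_square_of_mul_square r0); move: q1; congr is_square; ring.
have p2 : is_square (sg * tau * (k * k - 2 * e * e)).
  by apply: (is_square_of_mul_square t0); move: q2; congr is_square; ring.
have p3 : is_square (tau * (n * n + (n - k) * (n - k))).
  by apply: (is_square_of_mul_square s0); move: q3; congr is_square; ring.
rewrite /some_translate /all_square.
case: hsg htau => hsg [] htau; subst sg tau.
- by left; split; [|split]; [exists r | exists s | exists t]; lia.
- right; left; split; [|split].
  + by move: p1; congr is_square; ring.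
  + by exists (2 * s); move: es; rewrite /vnorm; lia.
  + by move: p2; congr is_square; ring.
- right; right; right; split; [|split].
  + by exists r; lia.
  + by move: p3; congr is_square; rewrite /vnorm; ring.
  + by move: p2; congr is_square; ring.
- right; right; left; split; [|split].
  + by move: p1; congr is_square; ring.
  + by move: p3; congr is_square; rewrite /vnorm; ring.
  + by exists (2 * t); lia.
Qed.

Lemma primitive_part n k d e : ~ (n = 0 /\ k = 0 /\ d = 0 /\ e = 0) ->
  exists c n' k' d' e', c <> 0 /\ n = c * n' /\ k = c * k' /\ d = c * d' /\ e = c * e' /\
    primitive n' k' d' e'.
Proof.
have [N] : exists N, Z.abs n + Z.abs k + Z.abs d + Z.abs e < Z.of_nat N.
  by exists (S (Z.abs_nat (Z.abs n + Z.abs k + Z.abs d + Z.abs e))); lia.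
elim: N n k d e => [|N IH] n k d e hN h0; first lia.
have [[p [pp [[n1 en] [[k1 ek] [[d1 ed] [e1 ee]]]]]]|none] := classic (exists p, prime p /\
  (Z.divide p n /\ Z.divide p k /\ Z.divide p d /\ Z.divide p e)); last first.
  exists 1, n, k, d, e; do 5 (split; first lia).
  by move=> p pp hp; apply: none; exists p.
have p1 : 2 <= p by case: pp; lia.
have [||c [n' [k' [d' [e' [c0 [en1 [ek1 [ed1 [ee1 prim]]]]]]]]]] := IH n1 k1 d1 e1.
- have le x y : x = y * p -> 2 * Z.abs y <= Z.abs x.
    by move=> ->; rewrite Z.abs_mul (Z.abs_eq p); nia.
  have := le _ _ en; have := le _ _ ek; have := le _ _ ed; have := le _ _ ee.
  by move: hN h0; subst; lia.
- by move=> z; apply: h0; subst; lia.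
by exists (c * p), n', k', d', e'; split; first nia; do 4 (split; first (subst; lia)).
Qed.

Lemma axial_scale c n k d e : c <> 0 -> axial (c * n) (c * k) (c * d) (c * e) ->
  axial n k d e.
Proof. by rewrite /axial => c0; have z x : c * x = 0 -> x = 0 by [nia]; intuition. Qed.

(** When [n^2 = e^2] the first class is undefined. A translation replaces [n^2 - e^2] by
    [k^2 - d^2], which cannot vanish too; the generic case applies there, and composing translations
    only permutes the four alternatives up to a factor 2. *)
Lemma all_square_translate n k d e : liftable n k d e -> primitive n k d e ->
  ~ axial n k d e -> some_translate all_square n k d e.
Proof.
move=> g prim na; have [ne|ne] := classic (n * n = e * e); last first.
  exact: all_square_translate_generic.
have [h _] := g.
have kd : k * k <> d * d.
  move=> kd; have v0 := kummer_vnorm_neq0 h na; have m0 := kummer_2nn_neq_dd h na.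
  have hq : k * (e - d) - n * (2 * e - d) = 0.
    by move: h; rewrite /kummer /vnorm => h; nia.
  have [en|en] : n = e \/ n = - e by nia.
    have [ek|ek] : k = d \/ k = - d by nia.
      by apply: v0; rewrite /vnorm; rewrite en ek in hq; lia.
    by apply: m0; rewrite en; rewrite en ek in hq; lia.
  have [ek|ek] : k = d \/ k = - d by nia.
    by apply: m0; rewrite en; rewrite en ek in hq; lia.
  by apply: v0; rewrite /vnorm; rewrite en ek in hq; lia.
have := primitive_part (n := k) (k := 2 * n) (d := 2 * e) (e := d).
case; first by move=> z; apply: na; rewrite /axial; lia.
move=> c [n' [k' [d' [e' [c0 [en [ek [ed [ee prim']]]]]]]]].
have g' : liftable n' k' d' e'.
  by apply: (liftable_scale c0); rewrite -en -ek -ed -ee; apply: liftable_translate1.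
have na' : ~ axial n' k' d' e'.
  rewrite /axial => z; apply: na; rewrite /axial.
  by case: z => [|[|[|]]] [z1 [z2 z3]]; rewrite ?z1 ?z2 ?z3 in en ek ed ee; lia.
have := all_square_translate_generic g' prim' na' ltac:(nia).
rewrite /some_translate => -[|[|[|]]] /(all_square_unscale c) hs.
- right; left; move: hs; congr all_square; lia.
- left; apply: (all_square_scale (c := 2)) => //.
  by move: hs; congr all_square; lia.
- right; right; right; apply: (all_square_scale (c := 2)) => //.
  by move: hs; congr all_square; lia.
- by right; right; left; move: hs; congr all_square; lia.
Qed.

(** * The isogeny 1 + i and its preimages *)

Definition height (n k d e : Z) : Z := k * k + 2 * n * n + d * d + 2 * e * e.

Lemma square_eq (x y : Z) : x * x = y * y -> x = y \/ x = - y.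
Proof.
move=> h; have : (x - y) * (x + y) = 0 by lia.
by case/Z.mul_eq_0; lia.
Qed.

Lemma mul_neq0 (x y : Z) : x <> 0 -> y <> 0 -> x * y <> 0.
Proof. by move=> hx hy /Z.mul_eq_0; tauto. Qed.

(* For [X = k + n sqrt 2] and [Y = d + e sqrt 2] one has [X^2 - Y^2 = A + 2 B sqrt 2] and
   [X Y = C + D sqrt 2].  The endomorphism of the Jacobian attached to
   [1 + ((x, y) |-> (-1/x, y/x^3))] acts on Kummer coordinates by
   [(2 B : A : 2 (2 D - C) : 2 (D - C))], that is, by squaring [X + i Y] in [Q(zeta_8)] up to a
   conjugation and the unit [1 + sqrt 2]; this is why it doubles heights. *)
Definition invA (n k d e : Z) : Z := k * k + 2 * n * n - d * d - 2 * e * e.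
Definition invB (n k d e : Z) : Z := n * k - e * d.
Definition invC (n k d e : Z) : Z := k * d + 2 * n * e.
Definition invD (n k d e : Z) : Z := k * e + n * d.

Definition isogeny_rel (x1 x2 x3 x4 c n k d e : Z) : Prop :=
  2 * invB x1 x2 x3 x4 = c * n /\ invA x1 x2 x3 x4 = c * k /\
  2 * (2 * invD x1 x2 x3 x4 - invC x1 x2 x3 x4) = c * d /\
  2 * (invD x1 x2 x3 x4 - invC x1 x2 x3 x4) = c * e.

(** As a quadratic in [k] the equation has leading coefficient [vnorm d e - n^2]; when this
    vanishes, [k] is governed by a linear equation. This serves the degenerate case of [halving]. *)
Lemma kummer_linear_form n k d e : kummer n k d e ->
  k * k * (vnorm d e - n * n) - 2 * n * k * (e - d) * (2 * e - d)
  + 2 * n * n * vnorm d e - e * e * d * d = 0.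
Proof. rewrite /kummer /vnorm; lia. Qed.

Lemma kummer_isogeny x1 x2 x3 x4 : kummer x1 x2 x3 x4 ->
  kummer (2 * invB x1 x2 x3 x4) (invA x1 x2 x3 x4)
    (2 * (2 * invD x1 x2 x3 x4 - invC x1 x2 x3 x4))
    (2 * (invD x1 x2 x3 x4 - invC x1 x2 x3 x4)).
Proof.
rewrite /kummer /vnorm /invA /invB /invC /invD => h.
set n := x1 in h *; set k := x2 in h *; set d := x3 in h *; set e := x4 in h *.
have := f_equal (fun z =>
    (16 * n * n * n * n + 16 * n * n * k * k - 48 * n * n * d * d + 128 * n * n * d * e
     - 96 * n * n * e * e + 64 * n * k * d * d - 256 * n * k * d * e
     + 128 * n * k * e * e + 4 * k * k * k * k - 24 * k * k * d * d + 64 * k * k * d * e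
     - 48 * k * k * e * e + 4 * d * d * d * d + 16 * d * d * e * e + 16 * e * e * e * e) * z) h.
lia.
Qed.

Ltac product_ring h1 h2 :=
  repeat split; solve [ring | rewrite h1; ring | rewrite h2; ring | rewrite -h1; ring |
    rewrite -h2; ring | rewrite -h2 h1; ring | rewrite -h1 h2; ring].

(* A vector is determined up to scaling by the products of its distinct coordinates. *)
Lemma product_system (p12 p13 p14 p23 p24 p34 : Z) :
  p12 * p34 = p13 * p24 -> p12 * p34 = p14 * p23 ->
  (p12 <> 0 /\ p13 <> 0 /\ p23 <> 0) \/ (p12 <> 0 /\ p14 <> 0 /\ p24 <> 0) \/
  (p13 <> 0 /\ p14 <> 0 /\ p34 <> 0) \/ (p23 <> 0 /\ p24 <> 0 /\ p34 <> 0) ->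
  exists m x1 x2 x3 x4, m <> 0 /\ x1 * x2 = m * p12 /\ x1 * x3 = m * p13 /\
    x1 * x4 = m * p14 /\ x2 * x3 = m * p23 /\ x2 * x4 = m * p24 /\ x3 * x4 = m * p34.
Proof.
move=> h1 h2 [|[|[|]]] [ha [hb hc]].
- exists (p12 * p13 * p23), (p12 * p13), (p12 * p23), (p13 * p23), (p14 * p23).
  split; first nia.
  by product_ring h1 h2.
- exists (p12 * p14 * p24), (p12 * p14), (p12 * p24), (p13 * p24), (p14 * p24).
  split; first nia.
  by product_ring h1 h2.
- exists (p13 * p14 * p34), (p13 * p14), (p12 * p34), (p13 * p34), (p14 * p34).
  split; first nia.
  by product_ring h1 h2.
- exists (p23 * p24 * p34), (p12 * p34), (p23 * p24), (p23 * p34), (p24 * p34).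
  split; first nia.
  by product_ring h1 h2.
Qed.

(* The roots [r], [s], [t] determine the products of the coordinates of a preimage under the
   isogeny; the last hypothesis selects the sign of [r s t] for which the preimage exists. *)
Lemma halving n k d e r s t : kummer n k d e -> ~ axial n k d e ->
  n * n - e * e = r * r -> vnorm d e = s * s -> 2 * n * n - d * d = t * t ->
  k * (vnorm d e - n * n) - n * (e - d) * (2 * e - d) = r * s * t ->
  exists x1 x2 x3 x4 c, c <> 0 /\ kummer x1 x2 x3 x4 /\ isogeny_rel x1 x2 x3 x4 c n k d e.
Proof.
move=> h na er es et ek.
have v0 := kummer_vnorm_neq0 h na.
have m0 := kummer_2nn_neq_dd h na.
have s0 : s <> 0 by move=> z; apply: v0; rewrite es z.
have t0 : t <> 0 by move=> z; apply: m0; rewrite z in et; lia.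
have degenerate : r = 0 -> s * s <> n * n.
  move=> r0 ss; rewrite r0 in er; rewrite -es in ss.
  have de : e = d by rewrite /vnorm in ss; nia.
  apply: v0; rewrite /vnorm de Z.sub_diag.
  have := f_equal (Z.mul (k * k)) er; have := f_equal (Z.mul (2 * e * e)) er.
  move: h; rewrite /kummer /vnorm de => h h1 h2.
  by have /Z.mul_eq_0 : e * e * (e * e) = 0 by [lia]; lia.
have key : n * (d - e) * (d - 2 * e) + r * s * t = k * (s * s - n * n) by rewrite -es; lia.
have vE : vnorm d e = e * e + (e - d) * (e - d) by [].
(* For a preimage, [x1 x2 - x3 x4], [x1 x3 + x2 x4] and [2 x1 x4 + x2 x3] are prescribed by [n],
   [d - e] and [d - 2 e]. Their companions [x1 x2 + x3 x4], [x1 x3 - x2 x4] and [2 x1 x4 - x2 x3]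
   are taken proportional to [s], [r] and [t]. Half sums and half differences give the six
   products. *)
have [|||m [x1 [x2 [x3 [x4 [m0' [h12 [h13 [h14 [h23 [h24 h34]]]]]]]]]]] :=
  @product_system (2 * (s + n)) (2 * (r + d - e)) (d - 2 * e + t) (2 * (d - 2 * e - t))
    (2 * (d - e - r)) (2 * (s - n)).
- by rewrite /vnorm in es; lia.
- by rewrite /vnorm in es; lia.
(* If [s^2 = n^2], one product vanishes in each complementary pair. The sign in [key] ensures that
   the other three involve only three coordinates; with the opposite sign they would share one
   coordinate, which no vector allows. *)
- have [P|P] := classic (s * s = n * n); last first.
    have P34 : s - n <> 0 by move=> z; apply: P; have -> : s = n by lia.
    have P12 : s + n <> 0 by move=> z; apply: P; have -> : s = - n by [lia]; ring.
    have P13 : r + d - e <> 0.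
      by move=> z; apply: P; have rE : r = e - d by [lia]; rewrite /vnorm rE in er es; lia.
    have P24 : d - e - r <> 0.
      by move=> z; apply: P; have rE : r = d - e by [lia]; rewrite /vnorm rE in er es; lia.
    have P14 : d - 2 * e + t <> 0.
      by move=> z; apply: P; have tE : t = 2 * e - d by [lia]; rewrite /vnorm tE in et es; lia.
    by left; lia.
  have r0 : r <> 0 by move=> r0; apply: (degenerate r0).
  have dv : (d - e) * (d - e) = r * r by rewrite /vnorm in es; lia.
  have dt : (d - 2 * e) * (d - 2 * e) = t * t by rewrite /vnorm in es; lia.
  have rst : r * s * t <> 0 by do 2 (apply: mul_neq0 => //).
  rewrite P Z.sub_diag Z.mul_0_r in key.
  have [nE|nE] : n = s \/ n = - s by apply: square_eq.
    have [dE|dE] : d - e = r \/ d - e = - r by apply: square_eq.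
      have [tE|tE] : d - 2 * e = t \/ d - 2 * e = - t by apply: square_eq.
        by exfalso; rewrite nE dE tE in key; lia.
      by left; lia.
    have [tE|tE] : d - 2 * e = t \/ d - 2 * e = - t by apply: square_eq.
      by right; left; lia.
    by exfalso; rewrite nE dE tE in key; lia.
  have [dE|dE] : d - e = r \/ d - e = - r by apply: square_eq.
    have [tE|tE] : d - 2 * e = t \/ d - 2 * e = - t by apply: square_eq.
      by right; right; left; lia.
    by exfalso; rewrite nE dE tE in key; lia.
  have [tE|tE] : d - 2 * e = t \/ d - 2 * e = - t by apply: square_eq.
    by exfalso; rewrite nE dE tE in key; lia.
  by right; right; right; lia.
exists x1, x2, x3, x4, (8 * m); split; first lia.
have eB : 2 * invB x1 x2 x3 x4 = 8 * m * n by rewrite /invB; lia.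
have eC : invC x1 x2 x3 x4 = 4 * m * (d - 2 * e) by rewrite /invC; lia.
have eD : invD x1 x2 x3 x4 = 4 * m * (d - e) by rewrite /invD; lia.
have hk : kummer x1 x2 x3 x4.
  have e12 : x1 * x2 + x3 * x4 = 4 * m * s by lia.
  have : (x1 * x2 + x3 * x4) * (x1 * x2 + x3 * x4) = invD x1 x2 x3 x4 * invD x1 x2 x3 x4 +
    (invC x1 x2 x3 x4 - invD x1 x2 x3 x4) * (invC x1 x2 x3 x4 - invD x1 x2 x3 x4).
    rewrite e12 eC eD; have := f_equal (Z.mul (16 * m * m)) es; rewrite /vnorm; lia.
  by rewrite /kummer /vnorm /invC /invD; lia.
split=> //; split=> //; split; last by rewrite eC eD; split; ring.
(* It remains to compare [invA] with [k]. Generically the identity [id] expresses [invA] by the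
   known products; if [s^2 = n^2], both numbers solve the same linear equation. *)
have [P|P] := classic (s * s = n * n); last first.
  have e4 : x1 * x2 * (x3 * x4) = 4 * m * m * (s * s - n * n) by rewrite h12 h34; ring.
  have id : invB x1 x2 x3 x4 * invC x1 x2 x3 x4 * invD x1 x2 x3 x4 +
    (x1 * x3 - x2 * x4) * (x1 * x2 + x3 * x4) * (2 * (x1 * x4) - x2 * x3) =
    2 * (x1 * x2 * (x3 * x4)) * invA x1 x2 x3 x4.
    by rewrite /invA /invB /invC /invD; ring.
  have eB' : invB x1 x2 x3 x4 = 4 * m * n by lia.
  rewrite eB' eC eD h12 h13 h14 h23 h24 h34 in id.
  apply: (Z.mul_reg_l _ _ (8 * m * m * (s * s - n * n))).
    by apply: mul_neq0; [apply: mul_neq0; lia | lia].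
  have := f_equal (Z.mul (64 * m * m * m)) key; lia.
have kl := kummer_linear_form h.
have kl' := kummer_linear_form (kummer_isogeny hk).
have -> : invA x1 x2 x3 x4 = 8 * m * k; last by [].
have r0 : r <> 0 by move=> r0; apply: (degenerate r0).
have rst : r * s * t <> 0 by do 2 (apply: mul_neq0 => //).
move: kl kl'; rewrite eB eC eD es P.
set A := invA _ _ _ _ => kl.
have -> : vnorm (2 * (2 * (4 * m * (d - e)) - 4 * m * (d - 2 * e)))
  (2 * (4 * m * (d - e) - 4 * m * (d - 2 * e))) = 64 * m * m * vnorm d e.
  by rewrite /vnorm; ring.
rewrite es P => kl'.
have : 1024 * m * m * m * (n * (d - e) * (d - 2 * e)) * (A - 8 * m * k) = 0.
  by have := f_equal (Z.mul (64 * 64 * m * m * m * m)) kl; lia.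
have : n * (d - e) * (d - 2 * e) = - (r * s * t) by move: key; rewrite P; lia.
move=> -> /Z.mul_eq_0 [|]; last lia.
by case/Z.mul_eq_0; [have := mul_neq0 (mul_neq0 m0' m0') m0'; lia | lia].
Qed.

Lemma sum_squares_eq0 (x y : Z) : x * x + y * y = 0 -> x = 0 /\ y = 0.
Proof. by move=> h; split; nia. Qed.

(** Put [W = w1 + i w2] and [W' = W1 + i W2]. Then [W W' v = (P + i Q)^2] and
    [4 W' = c^2 (a + i b)^2], so multiplying by the conjugate of [W'] gives
    [4 R^2 W v = (c (P + i Q) (a - i b))^2]. The conclusions are the squares of its real and
    imaginary parts. *)
Lemma complex_square_transfer (w1 w2 rho v W1 W2 R P Q a b c : Z) :
  (w1 * W1 - w2 * W2) * v = P * P - Q * Q -> (w1 * W2 + w2 * W1) * v = 2 * (P * Q) ->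
  rho * R * v = P * P + Q * Q -> R * R = W1 * W1 + W2 * W2 ->
  4 * R = c * c * (a * a + b * b) -> 4 * W1 = c * c * (a * a - b * b) ->
  2 * W2 = c * c * (a * b) ->
  R * R * (2 * (rho + w1) * v) = c * (a * P + b * Q) * (c * (a * P + b * Q)) /\
  R * R * (2 * (rho - w1) * v) = c * (a * Q - b * P) * (c * (a * Q - b * P)).
Proof.
move=> h1 h2 h3 hR ha hb hab.
have e1 : w1 * v * (R * R) = W1 * (P * P - Q * Q) + W2 * (2 * (P * Q)).
  by rewrite hR -h1 -h2; ring.
have e2 : rho * v * (R * R) = R * (P * P + Q * Q) by rewrite -h3; ring.
have f1 := f_equal (Z.mul (P * P + Q * Q)) ha.
have f2 := f_equal (Z.mul (P * P - Q * Q)) hb.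
have f3 := f_equal (Z.mul (P * Q)) hab.
by split; lia.
Qed.

Lemma kummer_rho_neq0 n k d e : kummer n k d e -> ~ axial n k d e -> n * k + e * d <> 0.
Proof.
move=> h na rho0; have m0 := kummer_2nn_neq_dd h na.
have := kummer_square4 h; rewrite rho0 => h4.
have [w1 w2'] : n * d + k * e = 0 /\ 2 * n * e + k * d - n * d - k * e = 0.
  by apply: sum_squares_eq0; lia.
have w2 : 2 * n * e + k * d = 0 by lia.
apply: na; rewrite /axial.
have [n0|n0] := classic (n = 0).
  rewrite n0 in rho0 w1 w2.
  have /Z.mul_eq_0 : e * d = 0 by lia.
  have /Z.mul_eq_0 : k * e = 0 by lia.
  have /Z.mul_eq_0 : k * d = 0 by lia.
  by lia.
have e0 : e = 0.
  have /Z.mul_eq_0 [//|] : e * (2 * n * n - d * d) = 0.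
    by have := f_equal (Z.mul n) w2; have := f_equal (Z.mul d) rho0; lia.
  by lia.
rewrite e0 in rho0 w1.
have /Z.mul_eq_0 : n * d = 0 by lia.
have /Z.mul_eq_0 : n * k = 0 by lia.
by lia.
Qed.

(* With [W = w1 + i w2] and [W' = w1' + i w2'] attached to a point and to its image, the first
   two identities say [W W' vnorm = (P + i Q)^2]. *)
Lemma twist_identities n k d e : kummer n k d e ->
  let w1 := - (n * d + k * e) in let w2 := 2 * n * e + k * d - n * d - k * e in
  let n0 := 2 * invB n k d e in let k0 := invA n k d e in
  let d0 := 2 * (2 * invD n k d e - invC n k d e) in
  let e0 := 2 * (invD n k d e - invC n k d e) in
  let w1' := - (n0 * d0 + k0 * e0) in let w2' := 2 * n0 * e0 + k0 * d0 - n0 * d0 - k0 * e0 in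
  let P := k * d * d * e - k * d * d * d + 4 * n * e * e * e - 2 * n * d * e * e
    - 2 * n * k * k * e + n * k * k * d - 2 * n * n * k * e + 2 * n * n * k * d in
  let Q := 4 * k * e * e * e - 2 * k * d * e * e - k * d * d * e + k * d * d * d
    - 4 * n * e * e * e + 2 * n * d * e * e + 2 * n * d * d * e - 2 * n * d * d * d
    + n * k * k * d - 2 * n * n * k * e in
  (w1 * w1' - w2 * w2') * vnorm d e = P * P - Q * Q /\
  (w1 * w2' + w2 * w1') * vnorm d e = 2 * (P * Q) /\
  (n * k + e * d) * (n0 * k0 + e0 * d0) * vnorm d e = P * P + Q * Q.
Proof.
rewrite /kummer /vnorm /invA /invB /invC /invD => h; split; [|split].
- have := f_equal (fun z =>
    (4 * n * n * d * d - 8 * n * n * d * e + 4 * n * k * d * d - 8 * n * k * d * e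
     + 8 * n * k * e * e - 4 * k * k * d * e + 4 * k * k * e * e) * z) h; lia.
- have := f_equal (fun z =>
    (- 8 * n * n * d * e + 8 * n * n * e * e + 4 * n * k * d * d - 8 * n * k * d * e
     + 8 * n * k * e * e + 2 * k * k * d * d - 4 * k * k * d * e) * z) h; lia.
- have := f_equal (fun z =>
    (4 * n * k * d * d - 16 * n * k * d * e + 8 * n * k * e * e - 2 * d * d * d * d
     + 4 * d * d * d * e - 8 * d * d * e * e + 8 * d * e * e * e - 8 * e * e * e * e) * z) h.
  lia.
Qed.

(** This keeps the descent on [J], away from its twists. The functions of [liftable] are
    [2 (rho + w1) vnorm] and [2 (rho - w1) vnorm] with [rho = n k + e d], as in
    [complex_square_transfer]; since [vnorm d e] is a square, liftability of the image makes its
    [W'] a square, up to the factor 4. *)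
Lemma liftable_of_isogeny x1 x2 x3 x4 c n k d e s : c <> 0 -> kummer x1 x2 x3 x4 ->
  isogeny_rel x1 x2 x3 x4 c n k d e -> liftable n k d e -> ~ axial n k d e ->
  vnorm d e = s * s -> liftable x1 x2 x3 x4.
Proof.
move=> c0 hx [eB [eA [eD eC]]] [h [h1 h2]] na es.
have s0 : s <> 0 by move=> z; apply: (kummer_vnorm_neq0 h na); rewrite es z.
have [a ha] : is_square (2 * (n - e) * (k - d)).
  by apply: (is_square_of_mul_square s0); move: h1; rewrite es; congr is_square; ring.
have [b [hb hab]] : exists b, 2 * (n + e) * (k + d) = b * b /\
    a * b = 2 * (2 * n * e + k * d - n * d - k * e).
  have [b hb] : is_square (2 * (n + e) * (k + d)).
    by apply: (is_square_of_mul_square s0); move: h2; rewrite es; congr is_square; ring.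
  have [e1|e1] : a * b = 2 * (2 * n * e + k * d - n * d - k * e) \/
                 a * b = - (2 * (2 * n * e + k * d - n * d - k * e)).
  - apply: square_eq; transitivity (a * a * (b * b)); first ring.
    by rewrite -ha -hb; have := kummer_square4 h; lia.
  - by exists b.
  - by exists (- b); split; lia.
have rho0 := kummer_rho_neq0 h na.
have [i1 [i2 i3]] := twist_identities hx.
have h4 := kummer_square4 (kummer_isogeny hx).
move: i1 i2 i3 h4; rewrite eB eA eD eC.
set P := (X in X * X - _); set Q := (X in _ - X * X) => i1 i2 i3 h4.
have R0 : (c * n) * (c * k) + (c * e) * (c * d) <> 0.
  have -> : c * n * (c * k) + c * e * (c * d) = c * c * (n * k + e * d) by ring.
  by do 2 (apply: mul_neq0 => //).
have [||||e1 e2] := complex_square_transfer (a := a) (b := b) (c := c) i1 i2 i3.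
- by rewrite h4; ring.
- by rewrite -ha -hb; ring.
- by rewrite -ha -hb; ring.
- by rewrite hab; ring.
split=> //; split; apply: (is_square_of_mul_square R0);
  [exists (c * (a * P + b * Q)); rewrite -e1 | exists (c * (a * Q - b * P)); rewrite -e2]; ring.
Qed.

(** * Growth of heights under the isogeny *)

Lemma height_isogeny n k d e :
  height n k d e * height n k d e <=
  4 * height (2 * invB n k d e) (invA n k d e)
    (2 * (2 * invD n k d e - invC n k d e)) (2 * (invD n k d e - invC n k d e)).
Proof.
set S := k * k + 2 * n * n; set U := d * d + 2 * e * e; set P := n * k; set V := d * e.
set X := S + U - 4 * (P + V); set Y := S - U + 2 * (P - V).
set C := invC n k d e; set D := invD n k d e.
(* The right side minus the left is [X^2 + 2 Y^2 + 8 (P - V)^2 + (8/5) ((5 C - 7 D)^2 + D^2)]. *)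
have := Z.square_nonneg X; have := Z.square_nonneg Y; have := Z.square_nonneg (P - V).
have := Z.square_nonneg (5 * C - 7 * D); have := Z.square_nonneg D.
rewrite /X /Y /S /U /P /V /C /D /height /invA /invB /invC /invD; lia.
Qed.

Lemma isogeny_content_prime p n k d e : prime p -> p <> 2 -> primitive n k d e ->
  Z.divide p (invA n k d e) -> Z.divide p (invB n k d e) -> Z.divide p (invC n k d e) ->
  Z.divide p (invD n k d e) -> False.
Proof.
move=> pp p2 prim pA pB pC pD.
have both x y S P : S = x * x + 2 * y * y -> P = x * y -> Z.divide p (S * P) ->
    Z.divide p (S * S + 8 * (P * P)) -> Z.divide p x /\ Z.divide p y.
  move=> eS eP pSP pSS.
  have [pS pP] : Z.divide p S /\ Z.divide p P.
    have [pS|pP] := prime_mult _ pp _ _ pSP; split=> //.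
      apply/(prime_divides_square pp)/(odd_prime_cancel2 pp p2)/(odd_prime_cancel2 pp p2).
      apply: (odd_prime_cancel2 pp p2).
      have -> : 2 * (2 * (2 * (P * P))) = S * S + 8 * (P * P) - S * S by ring.
      by auto with zdiv.
    apply: (prime_divides_square pp).
    have -> : S * S = S * S + 8 * (P * P) - 8 * P * P by ring.
    by auto with zdiv.
  rewrite eP in pP; have [px|py] := prime_mult _ pp _ _ pP; split=> //.
    apply/(prime_divides_square pp)/(odd_prime_cancel2 pp p2).
    have -> : 2 * (y * y) = S - x * x by rewrite eS; ring.
    by auto with zdiv.
  apply: (prime_divides_square pp).
  have -> : x * x = S - 2 * y * y by rewrite eS; ring.
  by auto with zdiv.
(* With [X = k + n sqrt 2] and [Y = d + e sqrt 2], the identity [X^4 = X^2 (X^2 - Y^2) + (X Y)^2]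
   makes [p] divide [X^4]; [both] recovers the coordinates of [X]. The same works for
   [Y^4 = (X Y)^2 - Y^2 (X^2 - Y^2)]. *)
have [pk pn] : Z.divide p k /\ Z.divide p n.
  apply: (both k n _ _ erefl erefl).
    apply: (odd_prime_cancel2 pp p2).
    have -> : 2 * ((k * k + 2 * n * n) * (k * n)) = invC n k d e * invD n k d e +
      k * n * invA n k d e + (k * k + 2 * n * n) * invB n k d e.
      by rewrite /invA /invB /invC /invD; ring.
    by auto 6 with zdiv.
  have -> : (k * k + 2 * n * n) * (k * k + 2 * n * n) + 8 * (k * n * (k * n)) =
    invC n k d e * invC n k d e + 2 * invD n k d e * invD n k d e +
    (k * k + 2 * n * n) * invA n k d e + 8 * (k * n) * invB n k d e.
    by rewrite /invA /invB /invC /invD; ring.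
  by auto 6 with zdiv.
have [pd pe] : Z.divide p d /\ Z.divide p e.
  apply: (both d e _ _ erefl erefl).
    apply: (odd_prime_cancel2 pp p2).
    have -> : 2 * ((d * d + 2 * e * e) * (d * e)) = invC n k d e * invD n k d e -
      d * e * invA n k d e - (d * d + 2 * e * e) * invB n k d e.
      by rewrite /invA /invB /invC /invD; ring.
    by auto 6 with zdiv.
  have -> : (d * d + 2 * e * e) * (d * d + 2 * e * e) + 8 * (d * e * (d * e)) =
    invC n k d e * invC n k d e + 2 * invD n k d e * invD n k d e -
    (d * d + 2 * e * e) * invA n k d e - 8 * (d * e) * invB n k d e.
    by rewrite /invA /invB /invC /invD; ring.
  by auto 6 with zdiv.
exact: (prime_not_primitive prim pp).
Qed.

Lemma isogeny_content_8 n k d e : primitive n k d e ->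
  Z.divide 8 (2 * invB n k d e) -> Z.divide 8 (invA n k d e) ->
  Z.divide 8 (2 * (2 * invD n k d e - invC n k d e)) ->
  Z.divide 8 (2 * (invD n k d e - invC n k d e)) -> False.
Proof.
move=> prim [b hb] [a ha] [c hc] [c' hc']; have np := prim 2 prime_2.
have half x : exists y, x = 2 * y \/ x = 2 * y + 1.
  by case: (Z.Even_or_Odd x) => -[y hy]; exists y; lia.
have ediv x y : x = 2 * y -> Z.divide 2 x by exists y; lia.
rewrite /invB in hb; rewrite /invA in ha; rewrite /invC /invD in hc hc'.
have [n' hn] := half n; have [k' hk] := half k.
have [d' hd] := half d; have [e' he] := half e.
have C4 : exists z, k * d + 2 * n * e = 4 * z by exists (c - 2 * c'); lia.
have D4 : exists z, k * e + n * d = 4 * z by exists (c - c'); lia.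
case: C4 D4 => z hz [w hw]; clear c c' hc hc'.
case: hk => hk; case: hd => hd; case: hn => hn; case: he => he;
  first by (apply: np; split; [|split; [|split]]; apply: ediv; eassumption).
all: rewrite hk hd hn he in ha hb hz hw; exfalso; clear - ha hb hz hw; lia.
Qed.

Lemma content_bound (g : Z) : g <> 0 -> (forall p, prime p -> p <> 2 -> ~ Z.divide p g) ->
  ~ Z.divide 8 g -> Z.abs g <= 4.
Proof.
move=> g0 no n8.
have odd h : Z.divide h g -> Z.divide 2 h \/ Z.abs h = 1.
  move=> hg; have [|h1] := classic (Z.abs h = 1); [by right | left].
  have h0 : h <> 0 by move=> z; apply: g0; case: hg => q ->; rewrite z; ring.
  have [p [pp ph]] := prime_divisor_exists h0 h1.
  have [e|p2] := classic (p = 2); first by rewrite -e.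
  by case: (no p pp p2); apply: Z.divide_trans hg.
have [[g1 e1]|] := odd g (Z.divide_refl g); last lia.
have [|[g2 e2]|] := odd g1 _; [by exists 2; lia | | by lia].
have [|[g3 e3]|] := odd g2 _; [by exists 4; lia | | by lia].
by case: n8; exists g3; lia.
Qed.

Lemma primitive_proportional c a x1 x2 x3 x4 y1 y2 y3 y4 : c <> 0 ->
  primitive y1 y2 y3 y4 -> c * x1 = a * y1 -> c * x2 = a * y2 -> c * x3 = a * y3 ->
  c * x4 = a * y4 -> exists w, x1 = w * y1 /\ x2 = w * y2 /\ x3 = w * y3 /\ x4 = w * y4.
Proof.
move=> c0 prim h1 h2 h3 h4.
have [g [c' [a' [g0 [ec [ea cop]]]]]] := coprime_parts a c0.
have red x y : c * x = a * y -> c' * x = a' * y.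
  by rewrite ec ea => h; apply: (Z.mul_reg_l _ _ g) => //; lia.
move: {h1}(red _ _ h1) {h2}(red _ _ h2) {h3}(red _ _ h3) {h4}(red _ _ h4) => h1 h2 h3 h4.
have c'0 : c' <> 0 by move=> z; apply: c0; rewrite ec z.
have [c1|c1] := classic (Z.abs c' = 1).
  have cc : c' * c' = 1 by nia.
  by exists (c' * a'); have m x y : c' * x = a' * y -> x = c' * a' * y by
    [move=> h; rewrite -Z.mul_assoc -h Z.mul_assoc cc Z.mul_1_l]; auto.
have [p [pp pc]] := prime_divisor_exists c'0 c1; case: (prim p pp).
have na : ~ Z.divide p a'.
  move=> pa; have [_ _ h] := cop; have := h p pc pa.
  by move/Z.divide_1_r => e; case: pp; lia.
have dv x y : c' * x = a' * y -> Z.divide p y.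
  move=> h; have : Z.divide p (a' * y) by rewrite -h; apply: Z.divide_mul_l.
  by case/(prime_mult _ pp).
by split; [|split; [|split]]; apply: dv; eassumption.
Qed.

Lemma height_pos n k d e : ~ axial n k d e -> 0 < height n k d e.
Proof.
move=> na; rewrite /height.
have := Z.square_nonneg n; have := Z.square_nonneg k.
have := Z.square_nonneg d; have := Z.square_nonneg e.
have p x : x <> 0 -> 0 < x * x by nia.
have [k0|/p] := classic (k = 0); last by lia.
have [n0|/p] := classic (n = 0); last by lia.
have [d0|/p] := classic (d = 0); last by lia.
by case: na; rewrite /axial; lia.
Qed.

(** * The descent step *)

Lemma descent_halving n k d e : liftable n k d e -> ~ axial n k d e -> all_square n k d e ->
  exists x1 x2 x3 x4 c c', c <> 0 /\ c' <> 0 /\ liftable x1 x2 x3 x4 /\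
    primitive x1 x2 x3 x4 /\
    c' * (2 * invB x1 x2 x3 x4) = c * n /\ c' * invA x1 x2 x3 x4 = c * k /\
    c' * (2 * (2 * invD x1 x2 x3 x4 - invC x1 x2 x3 x4)) = c * d /\
    c' * (2 * (invD x1 x2 x3 x4 - invC x1 x2 x3 x4)) = c * e.
Proof.
move=> g na [[r er] [[s es] [t et]]]; have [h _] := g.
(* [kummer_square3] fixes [r s t] only up to sign; changing the sign of [r] meets the requirement of
   [halving]. *)
have [r' [er' ek]] : exists r', n * n - e * e = r' * r' /\
    k * (vnorm d e - n * n) - n * (e - d) * (2 * e - d) = r' * s * t.
  have [ek|ek] : k * (vnorm d e - n * n) - n * (e - d) * (2 * e - d) = r * s * t \/
    k * (vnorm d e - n * n) - n * (e - d) * (2 * e - d) = - (r * s * t).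
  - by apply: square_eq; rewrite -(kummer_square3 h) er es et; ring.
  - by exists r.
  - by exists (- r); split; lia.
have [y1 [y2 [y3 [y4 [c [c0 [hy [e1 [e2 [e3 e4]]]]]]]]]] := halving h na er' es et ek.
have gy : liftable y1 y2 y3 y4.
  exact: (liftable_of_isogeny c0 hy (conj e1 (conj e2 (conj e3 e4))) g na es).
have y0 : ~ (y1 = 0 /\ y2 = 0 /\ y3 = 0 /\ y4 = 0).
  move=> [z1 [z2 [z3 z4]]]; apply: na; move: e1 e3 e4.
  rewrite /axial /invB /invC /invD z1 z2 z3 z4 => e1 e3 e4.
  by right; left; split; [|split]; nia.
have [b [x1 [x2 [x3 [x4 [b0 [d1 [d2 [d3 [d4 prim]]]]]]]]]] := primitive_part y0.
exists x1, x2, x3, x4, c, (b * b); split=> //; split; first exact: mul_neq0.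
split; first by apply: (liftable_scale b0); rewrite -d1 -d2 -d3 -d4.
split=> //; rewrite -e1 -e2 -e3 -e4 d1 d2 d3 d4 /invA /invB /invC /invD.
by split; [|split; [|split]]; ring.
Qed.

Lemma descent_height x1 x2 x3 x4 c c' n k d e : c <> 0 -> c' <> 0 -> primitive x1 x2 x3 x4 ->
  ~ axial n k d e ->
  c' * (2 * invB x1 x2 x3 x4) = c * n -> c' * invA x1 x2 x3 x4 = c * k ->
  c' * (2 * (2 * invD x1 x2 x3 x4 - invC x1 x2 x3 x4)) = c * d ->
  c' * (2 * (invD x1 x2 x3 x4 - invC x1 x2 x3 x4)) = c * e ->
  height x1 x2 x3 x4 * height x1 x2 x3 x4 <= 64 * height n k d e.
Proof.
move=> c0 c'0 prim na e1 e2 e3 e4.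
have H1 := @height_isogeny x1 x2 x3 x4.
move: H1 e1 e2 e3 e4; set B := 2 * invB _ _ _ _; set A := invA _ _ _ _.
set E := 2 * (invD _ _ _ _ - _); set D := 2 * (2 * _ - _) => H1 e1 e2 e3 e4.
have nz : ~ (B = 0 /\ A = 0 /\ D = 0 /\ E = 0).
  move=> [z1 [z2 [z3 z4]]]; apply: na; rewrite z1 z3 z4 in e1 e3 e4.
  by rewrite /axial; right; left; split; [|split]; nia.
have [q [y1 [y2 [y3 [y4 [q0 [d1 [d2 [d3 [d4 primy]]]]]]]]]] := primitive_part nz.
have [||||w [w1 [w2 [w3 w4]]]] :=
  @primitive_proportional c (c' * q) n k d e y1 y2 y3 y4 c0 primy.
- by rewrite -e1 d1; ring.
- by rewrite -e2 d2; ring.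
- by rewrite -e3 d3; ring.
- by rewrite -e4 d4; ring.
have w0 : w <> 0.
  by move=> z; apply: na; rewrite /axial w1 w3 w4 z; right; left; lia.
have q4 : Z.abs q <= 4.
  have dq z y : z = q * y -> forall g, Z.divide g q -> Z.divide g z.
    by move=> -> g hg; apply: Z.divide_mul_l.
  apply: content_bound => // [p pp p2 pq|q8].
    have pB := dq _ _ d1 p pq; have pA := dq _ _ d2 p pq.
    have /(odd_prime_cancel2 pp p2) pD := dq _ _ d3 p pq.
    have /(odd_prime_cancel2 pp p2) pE := dq _ _ d4 p pq.
    have pd : Z.divide p (invD x1 x2 x3 x4).
      have -> : invD x1 x2 x3 x4 = 2 * invD x1 x2 x3 x4 - invC x1 x2 x3 x4
        - (invD x1 x2 x3 x4 - invC x1 x2 x3 x4) by ring.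
      by auto with zdiv.
    apply: (isogeny_content_prime pp p2 prim pA) => //; first exact: (odd_prime_cancel2 pp p2).
    have -> : invC x1 x2 x3 x4 =
      invD x1 x2 x3 x4 - (invD x1 x2 x3 x4 - invC x1 x2 x3 x4) by ring.
    by auto with zdiv.
  by apply: (isogeny_content_8 prim); [exact: (dq _ _ d1) | exact: (dq _ _ d2) |
    exact: (dq _ _ d3) | exact: (dq _ _ d4)].
have Hy : 0 <= height y1 y2 y3 y4.
  rewrite /height; have := Z.square_nonneg y1; have := Z.square_nonneg y2.
  by have := Z.square_nonneg y3; have := Z.square_nonneg y4; lia.
have eq1 : height B A D E = q * q * height y1 y2 y3 y4 by rewrite /height d1 d2 d3 d4; ring.
have eq2 : height n k d e = w * w * height y1 y2 y3 y4 by rewrite /height w1 w2 w3 w4; ring.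
have qq : q * q <= 16 by nia.
have ww : 1 <= w * w by nia.
rewrite eq1 in H1; rewrite eq2.
have := Z.mul_le_mono_nonneg_r _ _ _ Hy qq; have := Z.mul_le_mono_nonneg_r _ _ _ Hy ww.
lia.
Qed.

(* The coordinates, up to scaling, of the 20 rational points of the Jacobian. *)
Definition torsion_coords (n k d e : Z) : Prop :=
  axial n k d e \/ (n = 0 /\ d = e /\ k * k = d * d) \/ (e = 0 /\ n = k /\ d * d = n * n) \/
  (k = 0 /\ d = 2 * e /\ n * n = e * e) \/ (d = 0 /\ k = 2 * n /\ e * e = n * n).

Lemma torsion_coords_unscale c n k d e : c <> 0 ->
  torsion_coords (c * n) (c * k) (c * d) (c * e) -> torsion_coords n k d e.
Proof.
move=> c0; have z x y : c * x = c * y -> x = y by apply: Z.mul_reg_l.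
have z0 x : c * x = 0 -> x = 0 by move=> h; apply: z; lia.
have zz x y : c * x * (c * x) = c * y * (c * y) -> x * x = y * y.
  by move=> h; apply: (Z.mul_reg_l _ _ (c * c)); [exact: mul_neq0 | lia].
have z2 x y : c * x = 2 * (c * y) -> x = 2 * y by move=> h; apply: z; lia.
rewrite /torsion_coords => -[/(axial_scale c0)|[|[|[|]]]] h; [by left | right..].
- by left; intuition.
- by right; left; intuition.
- by right; right; left; intuition.
- by right; right; right; intuition.
Qed.

Lemma torsion_coords_scale c n k d e :
  torsion_coords n k d e -> torsion_coords (c * n) (c * k) (c * d) (c * e).
Proof.
have zz x y : x * x = y * y -> c * x * (c * x) = c * y * (c * y).
  by move=> h; have -> : c * x * (c * x) = c * c * (x * x) by [ring]; rewrite h; ring.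
rewrite /torsion_coords => -[|[|[|[|]]]] h'; [left | right..].
- by move: h'; rewrite /axial => -[|[|[|]]] [-> [-> ->]]; lia.
- by left; case: h' => [-> [-> /zz h]]; lia.
- by right; left; case: h' => [-> [-> /zz h]]; lia.
- by right; right; left; case: h' => [-> [-> /zz h]]; lia.
- by right; right; right; case: h' => [-> [-> /zz h]]; lia.
Qed.

(** The 2-torsion is killed, going to the origin [(0 : 1 : 0 : 0)], and the other points land in the
    family [e = 0]. *)
Lemma torsion_coords_isogeny n k d e : torsion_coords n k d e ->
  torsion_coords (2 * invB n k d e) (invA n k d e)
    (2 * (2 * invD n k d e - invC n k d e)) (2 * (invD n k d e - invC n k d e)).
Proof.
rewrite /torsion_coords /axial /invA /invB /invC /invD.
case=> [[[-> [-> ->]]|[[-> [-> ->]]|[[-> [-> ->]]|[-> [-> ->]]]]]|[|[|[|]]]].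
1-4: by left; lia.
- by move=> [-> [-> h]]; right; right; left; rewrite h; split; [|split]; nia.
- by move=> [-> [-> h]]; right; right; left; split; [|split]; nia.
- by move=> [-> [-> h]]; right; right; left; split; [|split]; nia.
- by move=> [-> [-> h]]; right; right; left; split; [|split]; nia.
Qed.

Lemma axial_translate1 n k d e : axial k (2 * n) (2 * e) d -> axial n k d e.
Proof. by rewrite /axial; lia. Qed.

Lemma axial_translate3 n k d e : axial (- e) (- d) k n -> axial n k d e.
Proof. by rewrite /axial; lia. Qed.

Lemma torsion_coords_translate1 n k d e :
  torsion_coords k (2 * n) (2 * e) d -> torsion_coords n k d e.
Proof.
rewrite /torsion_coords => -[/axial_translate1|[|[|[|]]]] h; [by left | right..].
- by right; right; left; lia.
- move: h => [-> [-> h]]; right; right; right; lia.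
- by left; lia.
- move: h => [he [hk h]]; right; left; have -> : k = n by [lia]; lia.
Qed.

Lemma torsion_coords_translate3 n k d e :
  torsion_coords (- e) (- d) k n -> torsion_coords n k d e.
Proof.
rewrite /torsion_coords => -[/axial_translate3|[|[|[|]]]] h; [by left | right..].
- move: h => [he [hk h]]; right; left; have -> : k = n by [lia]; lia.
- move: h => [hn [hk h]]; left; have -> : d = e by [lia]; lia.
- by right; right; right; lia.
- by right; right; left; lia.
Qed.

(** The weights in [height] make each translation multiply it by 1 or 2, which turns the 64 of
    [descent_height] into 128. *)
Lemma descent_step n k d e : liftable n k d e -> primitive n k d e -> ~ axial n k d e ->
  exists x1 x2 x3 x4, liftable x1 x2 x3 x4 /\ primitive x1 x2 x3 x4 /\
    height x1 x2 x3 x4 * height x1 x2 x3 x4 <= 128 * height n k d e /\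
    (torsion_coords x1 x2 x3 x4 -> torsion_coords n k d e).
Proof.
move=> g prim na; have [h _] := g; have v0 := kummer_vnorm_neq0 h na.
suff H n' k' d' e' : liftable n' k' d' e' -> ~ axial n' k' d' e' -> all_square n' k' d' e' ->
    height n' k' d' e' <= 2 * height n k d e ->
    (torsion_coords n' k' d' e' -> torsion_coords n k d e) ->
    exists x1 x2 x3 x4, liftable x1 x2 x3 x4 /\ primitive x1 x2 x3 x4 /\
    height x1 x2 x3 x4 * height x1 x2 x3 x4 <= 128 * height n k d e /\
    (torsion_coords x1 x2 x3 x4 -> torsion_coords n k d e).
  have hp := height_pos na.
  have na1 := fun a => na (axial_translate1 a); have na3 := fun a => na (axial_translate3 a).
  have na2 := fun a => na3 (axial_translate1 a).
  have g3 := liftable_translate3 g v0.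
  case: (all_square_translate g prim na) => [|[|[|]]] sq.
  - by apply: (H _ _ _ _ g na sq) => //; lia.
  - apply: (H _ _ _ _ (liftable_translate1 g) na1 sq); last exact: torsion_coords_translate1.
    by rewrite /height; lia.
  - apply: (H _ _ _ _ (liftable_translate1 g3) na2 sq).
      by rewrite /height; lia.
    by move/torsion_coords_translate1/torsion_coords_translate3.
  - apply: (H _ _ _ _ g3 na3 sq); last exact: torsion_coords_translate3.
    by move: hp; rewrite /height; lia.
move=> g' na' sq hh hk.
have [x1 [x2 [x3 [x4 [c [c' [c0 [c'0 [gx [px [e1 [e2 [e3 e4]]]]]]]]]]]]] :=
  descent_halving g' na' sq.
exists x1, x2, x3, x4; do 2 (split=> //); split.
  by have := descent_height c0 c'0 px na' e1 e2 e3 e4; lia.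
move/torsion_coords_isogeny => kx; apply: hk; apply: (torsion_coords_unscale c0).
by rewrite -e1 -e2 -e3 -e4; apply: torsion_coords_scale.
Qed.

(** * Enumeration of points of small height *)

Definition is_squareb (m : Z) : bool := Z.eqb (Z.sqrt m * Z.sqrt m) m.

Lemma is_squareP m : is_square m -> is_squareb m = true.
Proof.
case=> a ->; rewrite /is_squareb -(Z.abs_square a) Z.sqrt_square; last lia.
exact: Z.eqb_refl.
Qed.

Definition torsion_coordsb (n k d e : Z) : bool :=
  let z := Z.eqb 0 in
  [|| z k && z d && z e, z n && z d && z e, z n && z k && z e, z n && z k && z d,
      z n && z (d - e) && z (k * k - d * d), z e && z (n - k) && z (d * d - n * n),
      z k && z (d - 2 * e) && z (n * n - e * e) | z d && z (k - 2 * n) && z (e * e - n * n)].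

Definition small_torsion (n k d e : Z) : bool :=
  ~~ Z.leb (height n k d e) 128 ||
  ~~ Z.eqb (vnorm d e * (n * n + (n - k) * (n - k))) ((n * k - e * d) * (n * k - e * d)) ||
  ~~ is_squareb (2 * (n - e) * (k - d) * vnorm d e) ||
  ~~ is_squareb (2 * (n + e) * (k + d) * vnorm d e) || torsion_coordsb n k d e.

Fixpoint all_from (i : Z) (N : nat) (f : Z -> bool) : bool :=
  if N is S N' then f i && all_from (i + 1) N' f else true.

Lemma all_fromP i N f j : all_from i N f = true -> i <= j < i + Z.of_nat N -> f j = true.
Proof.
elim: N i => [|N IH] i /=; first by lia.
move=> /andP [fi /IH h] hj; have [<-|ne] := classic (i = j); first exact: fi.
by apply: h; lia.
Qed.

(** The box comes from [11^2 <= 128 < 12^2] for [k] and [d], and [2 * 8^2 <= 128 < 2 * 9^2] for [n]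
    and [e]; an overall sign change gives [0 <= k]. *)
Lemma small_torsion_all :
  all_from 0 12 (fun k => all_from (-11) 23 (fun d =>
    all_from (-8) 17 (fun n => all_from (-8) 17 (fun e => small_torsion n k d e)))) = true.
Proof. by vm_compute. Qed.

Lemma torsion_coordsP n k d e : torsion_coordsb n k d e = true -> torsion_coords n k d e.
Proof.
have zP x : Z.eqb 0 x -> x = 0 by move/Z.eqb_eq.
rewrite /torsion_coordsb /torsion_coords /axial; cbv zeta.
do 7 (case/orP => [/andP [/andP [/zP h1 /zP h2] /zP h3]|]; first by clear zP; intuition lia).
by move=> /andP [/andP [/zP h1 /zP h2] /zP h3]; clear zP; intuition lia.
Qed.

Lemma torsion_of_small n k d e : liftable n k d e -> 0 <= k -> height n k d e <= 128 ->
  torsion_coords n k d e.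
Proof.
move=> [h [h1 h2]] k0 hh; apply: torsion_coordsP.
have sq x B : x * x <= 128 -> 128 < B * B -> 0 <= B -> - B < x < B by nia.
have bounds : - 12 < k < 12 /\ - 12 < d < 12 /\ - 9 < n < 9 /\ - 9 < e < 9.
  have := Z.square_nonneg n; have := Z.square_nonneg k.
  have := Z.square_nonneg d; have := Z.square_nonneg e; move: hh; rewrite /height => *.
  by split; [|split; [|split]]; nia.
have h3 := @all_fromP _ _ _ k small_torsion_all ltac:(lia).
have h4 := @all_fromP _ _ _ d h3 ltac:(lia).
have h5 := @all_fromP _ _ _ n h4 ltac:(lia).
have := @all_fromP _ _ _ e h5 ltac:(lia).
rewrite /small_torsion (proj2 (Z.leb_le _ _) hh) (proj2 (Z.eqb_eq _ _) h).
by rewrite (is_squareP h1) (is_squareP h2).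
Qed.

Theorem liftable_torsion n k d e : liftable n k d e -> torsion_coords n k d e.
Proof.
suff prim_case m n' k' d' e' : height n' k' d' e' < Z.of_nat m -> primitive n' k' d' e' ->
    liftable n' k' d' e' -> torsion_coords n' k' d' e'.
  move=> g; have [[-> [-> [-> ->]]]|nz] := classic (n = 0 /\ k = 0 /\ d = 0 /\ e = 0).
    by left; left.
  have [c [n' [k' [d' [e' [c0 [en [ek [ed [ee prim]]]]]]]]]] := primitive_part nz.
  rewrite en ek ed ee in g *; apply: torsion_coords_scale; have g' := liftable_scale c0 g.
  by apply: (prim_case (S (Z.abs_nat (height n' k' d' e')))) => //; lia.
elim: m n' k' d' e' => [|m IH] {}n {}k {}d {}e hm prim g.
  have [a|/height_pos] := classic (axial n k d e); [by left | lia].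
have [hh|hh] := Z.le_gt_cases (height n k d e) 128.
  have [k0|k0] := Z.le_gt_cases 0 k; first exact: torsion_of_small.
  apply: (@torsion_coords_unscale (-1)) => //; apply: torsion_of_small; last 1 first.
  - by move: hh; rewrite /height; lia.
  - by apply: (@liftable_scale (-1)) => //; move: g; congr liftable; lia.
  - by lia.
have [a|na] := classic (axial n k d e); first by left.
have [x1 [x2 [x3 [x4 [gx [px [hx kx]]]]]]] := descent_step g prim na.
(* Above 128, a square at most [128 * height] forces a strictly smaller height. *)
by apply: kx; apply: IH => //; nia.
Qed.

End KummerDescent.

(** * Quadratic points on the genus two curve *)

From mathcomp Require Import ssrnat ssrZ ring.
Local Open Scope ring_scope.

Definition ratz (z : Z) : rat := (int_of_Z z)%:~R.

Lemma ratzD x y : ratz (x + y)%Z = ratz x + ratz y.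
Proof. by rewrite /ratz -intrD; congr intmul; exact: (rmorphD int_of_Z x y). Qed.

Lemma ratzN x : ratz (- x)%Z = - ratz x.
Proof. by rewrite /ratz -mulrNz; congr intmul; exact: (rmorphN int_of_Z x). Qed.

Lemma ratzB x y : ratz (x - y)%Z = ratz x - ratz y.
Proof. by rewrite -Z.add_opp_r ratzD ratzN. Qed.

Lemma ratzM x y : ratz (x * y)%Z = ratz x * ratz y.
Proof. by rewrite /ratz -intrM; congr intmul; exact: (rmorphM int_of_Z x y). Qed.

Lemma ratz_inj : injective ratz.
Proof. by move=> x y /intr_inj /(can_inj int_of_ZK). Qed.

Lemma ratz_neq0 x : x <> 0%Z -> ratz x != 0.
Proof. by move=> h; apply/eqP => e; apply: h; apply: ratz_inj. Qed.

Lemma ratzE (x : rat) : exists a b : Z, b <> 0%Z /\ ratz b * x = ratz a.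
Proof.
exists (Z_of_int (numq x)), (Z_of_int (denq x)); rewrite /ratz !Z_of_intK; split.
  move=> h; have := denq_neq0 x; rewrite -(Z_of_intK (denq x)) h.
  by rewrite eqxx.
by rewrite mulrC -{1}(divq_num_den x) divfK // intr_eq0 denq_neq0.
Qed.

Lemma common_denominator (n k d e : rat) : exists N n' k' d' e' : Z, N <> 0%Z /\
  [/\ ratz n' = ratz N * n, ratz k' = ratz N * k, ratz d' = ratz N * d & ratz e' = ratz N * e].
Proof.
have [a1 [b1 [h1 e1]]] := ratzE n; have [a2 [b2 [h2 e2]]] := ratzE k.
have [a3 [b3 [h3 e3]]] := ratzE d; have [a4 [b4 [h4 e4]]] := ratzE e.
exists (b1 * b2 * (b3 * b4))%Z, (a1 * b2 * (b3 * b4))%Z, (b1 * a2 * (b3 * b4))%Z,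
  (b1 * b2 * (a3 * b4))%Z, (b1 * b2 * (b3 * a4))%Z.
split; first by do 3 (try apply: mul_neq0).
by split; rewrite !ratzM -?e1 -?e2 -?e3 -?e4; ring.
Qed.

Definition rat_kummer (n k d e : rat) : Prop :=
  (e * e + (e - d) * (e - d)) * (n * n + (n - k) * (n - k)) =
  (n * k - e * d) * (n * k - e * d).

Lemma rat_liftable_torsion (n k d e s1 s2 : rat) : rat_kummer n k d e ->
  2 * (n - e) * (k - d) * (e * e + (e - d) * (e - d)) = s1 * s1 ->
  2 * (n + e) * (k + d) * (e * e + (e - d) * (e - d)) = s2 * s2 ->
  [\/ [/\ k = 0, d = 0 & e = 0], [/\ n = 0, k = 0 & d = 0], n = 0 /\ e = 0
    | [\/ n = 0 /\ d = e, e = 0 /\ d * d = n * n | n * n = e * e]].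
Proof.
move=> h h1 h2.
have [N [n' [k' [d' [e' [N0 [en ek ed ee]]]]]]] := common_denominator n k d e.
have r2 : ratz 2 = 2 by [].
have sq (s : rat) (m : Z) :
    ratz m = ratz N * ratz N * (ratz N * ratz N) * (s * s) -> is_square m.
  have [a [b [b0 eb]]] := ratzE s => em.
  apply: (is_square_of_mul_square b0); exists (N * N * a)%Z; apply: ratz_inj.
  by rewrite !ratzM em -eb; ring.
have lift : liftable n' k' d' e'.
  split; [|split].
  - apply: ratz_inj; rewrite /vnorm !(ratzM, ratzD, ratzB) en ek ed ee.
    transitivity (ratz N * ratz N * (ratz N * ratz N) *
      ((e * e + (e - d) * (e - d)) * (n * n + (n - k) * (n - k)))); first ring.
    by rewrite h; ring.
  - apply: (sq s1); rewrite -h1 /vnorm !(ratzM, ratzD, ratzB) en ek ed ee r2; ring.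
  - apply: (sq s2); rewrite -h2 /vnorm !(ratzM, ratzD, ratzB) en ek ed ee r2; ring.
have NQ := ratz_neq0 N0.
have z (x : rat) (x' : Z) : ratz x' = ratz N * x -> x' = 0%Z -> x = 0.
  by move=> hx x0; apply/eqP; move/eqP: hx; rewrite x0 eq_sym mulf_eq0 (negPf NQ).
have zz (x y : rat) (x' y' : Z) : ratz x' = ratz N * x -> ratz y' = ratz N * y ->
    x' = y' -> x = y.
  by move=> hx hy hxy; apply: (mulfI NQ); rewrite -hx -hy hxy.
have zs (x y : rat) (x' y' : Z) : ratz x' = ratz N * x -> ratz y' = ratz N * y ->
    (x' * x')%Z = (y' * y')%Z -> x * x = y * y.
  move=> hx hy hxy; apply: (mulfI NQ); apply: (mulfI NQ).
  transitivity (ratz (x' * x')%Z); first by rewrite ratzM hx; ring.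
  by rewrite hxy ratzM hy; ring.
case: (liftable_torsion lift) => [[|[|[|]]]|[|[|[|]]]] [x1 [x2 x3]].
- by constructor 1; split; apply: z; eassumption.
- by constructor 3; split; apply: z; eassumption.
- by constructor 3; split; apply: z; eassumption.
- by constructor 2; split; apply: z; eassumption.
- by constructor 4; constructor 1; split; [apply: z | apply: zz]; eassumption.
- by constructor 4; constructor 2; split; [apply: z | apply: zs]; eassumption.
- by constructor 4; constructor 3; apply: zs; eassumption.
- by constructor 4; constructor 3; apply/esym/zs; eassumption.
Qed.

(* The hypotheses say that [y = p x + q] satisfies [y^2 = x (x^2 + 1) (x^2 + 2 x - 1)] modulo
   [x^2 + b x + c]. *)
Lemma rational_quadratic_relation (b c p q : rat) :
  2 * (p * q) =
    b ^+ 4 - 3 * b ^+ 2 * c + c ^+ 2 - 2 * b ^+ 3 + 4 * b * c - 2 * b - 1 + b * p ^+ 2 ->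
  q ^+ 2 =
    b ^+ 3 * c - 2 * b * c ^+ 2 - 2 * b ^+ 2 * c + 2 * c ^+ 2 - 2 * c + c * p ^+ 2 ->
  [\/ b = 0 /\ c = 1, b = 2 /\ c = -1, b = 0 /\ c = -1 | (b ^+ 2 = 4 /\ c = 1) \/ c = 0].
Proof.
set f1 := (X in _ = X + _); set f0 := (X in _ -> _ = X + _ -> _) => E1 E0.
(* Eliminating [q] gives [(f1 + b p^2)^2 = 4 p^2 (f0 + c p^2)], a quadratic in [p^2]; [k] is [p^2]
   shifted so that this becomes the Kummer quartic. *)
pose k := b ^+ 3 - 2 * b ^+ 2 - b * c + c - 1 + p ^+ 2.
pose d := 1 - c - b.
have u1 : 2 * (p * q) - (f1 + b * p ^+ 2) = 0 by rewrite E1 subrr.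
have u0 : q ^+ 2 - (f0 + c * p ^+ 2) = 0 by rewrite E0 subrr.
have K : rat_kummer (1 + c) k d (1 - c).
  apply/eqP; rewrite -subr_eq0; apply/eqP.
  transitivity ((2 * (p * q) - (f1 + b * p ^+ 2)) *
      (2 * (p * q) - (f1 + b * p ^+ 2) - 4 * (p * q))
    + 4 * p ^+ 2 * (q ^+ 2 - (f0 + c * p ^+ 2))).
    by rewrite /k /d /f1 /f0; ring.
  by rewrite u1 u0; ring.
(* Both are linear in [p] and [q], so they change sign with [y]: functions on [J] whose squares
   descend to the Kummer surface. *)
pose s1 := 2 * (b * c * p - (1 - c + b ^+ 2) * q); pose s2 := 2 * ((1 - c) * p + b * q).
have S1 : 2 * (1 + c - (1 - c)) * (k - d) *
    ((1 - c) * (1 - c) + (1 - c - d) * (1 - c - d)) = s1 * s1.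
  apply/eqP; rewrite -subr_eq0; apply/eqP.
  transitivity (4 * b * c * (1 - c + b ^+ 2) * (2 * (p * q) - (f1 + b * p ^+ 2))
    - 4 * (1 - c + b ^+ 2) ^+ 2 * (q ^+ 2 - (f0 + c * p ^+ 2))).
    by rewrite /s1 /k /d /f1 /f0; ring.
  by rewrite u1 u0; ring.
have S2 : 2 * (1 + c + (1 - c)) * (k + d) *
    ((1 - c) * (1 - c) + (1 - c - d) * (1 - c - d)) = s2 * s2.
  apply/eqP; rewrite -subr_eq0; apply/eqP.
  transitivity (- 4 * (1 - c) * b * (2 * (p * q) - (f1 + b * p ^+ 2))
    - 4 * b ^+ 2 * (q ^+ 2 - (f0 + c * p ^+ 2))).
    by rewrite /s2 /k /d /f1 /f0; ring.
  by rewrite u1 u0; ring.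
have dbl0 (x : rat) : x + x = 0 -> x = 0 by move/eqP; rewrite -mulr2n mulrn_eq0 => /eqP.
have sub0 (x y : rat) : x - y = 0 -> x = y by move/eqP; rewrite subr_eq0 => /eqP.
(* Since [n + e = 2], the case [n = e = 0] is void. The others give [x^2 + 1], [x^2 + 2 x - 1], or a
   polynomial with a rational root. *)
case: (rat_liftable_torsion K S1 S2) => [[_ hd he]|[hn _ hd]|[hn he]|[[hn hd]|[he hd]|hq]].
- have c1 : c = 1 by apply/esym/sub0.
  constructor 1; split=> //; move: hd; rewrite /d c1 subrr sub0r => /eqP.
  by rewrite oppr_eq0 => /eqP.
- have c1 : c = -1 by apply: sub0; rewrite opprK addrC.
  by constructor 2; split=> //; move: hd; rewrite /d c1 => /sub0 <-.
- exfalso; have : 1 + c + (1 - c) = 0 by rewrite hn he addr0.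
  by have -> : 1 + c + (1 - c) = 2 by [ring].
- have c1 : c = -1 by apply: sub0; rewrite opprK addrC.
  constructor 3; split=> //; move: hd; rewrite /d c1 => e.
  apply: sub0; apply/eqP; rewrite -oppr_eq0; apply/eqP.
  by transitivity (1 - -1 - b - (1 - -1)); [ring | rewrite e subrr].
- have c1 : c = 1 by apply/esym/sub0.
  constructor 4; left; split=> //; move: hd; rewrite /d c1 => e.
  by transitivity ((1 - 1 - b) * (1 - 1 - b)); [ring | rewrite e; ring].
- constructor 4; right; apply/(dbl0 c)/(dbl0 (c + c)).
  transitivity ((1 + c) * (1 + c) - (1 - c) * (1 - c)); first ring.
  by rewrite hq subrr.
Qed.

Section Quadratic.
Variables (K : fieldExtType rat) (hK : \dim {: K} = 2%N) (x : K) (hx : x \notin 1%VS).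

Lemma quadratic_independent (a b : rat) : a *: x + b%:A = 0 -> a = 0 /\ b = 0.
Proof.
move=> e; have [a0|a0] := eqVneq a 0; last first.
  case/negP: hx; have -> : x = (- (b / a))%:A.
    apply: (scalerI a0); rewrite scalerA mulrN mulrC divfK // scaleNr.
    by apply/eqP; rewrite -addr_eq0 e.
  by rewrite memvZ // mem1v.
split=> //; move: e; rewrite a0 scale0r add0r => /eqP.
by rewrite scaler_eq0 oner_eq0 orbF => /eqP.
Qed.

Lemma quadratic_coordinates (y : K) : exists p q : rat, y = p *: x + q%:A.
Proof.
have fr : free [:: x; 1].
  rewrite free_cons span_seq1; apply/andP; split=> //.
  by rewrite free_cons nil_free span_nil memv0 oner_eq0.
have : basis_of fullv [:: x; 1] by rewrite basisEfree fr subvf hK.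
move/span_basis; have : y \in {: K}%VS by exact: memvf.
move=> + e; rewrite -e span_cons span_seq1.
case/memv_addP => [_ /vlineP [p ->] [_ /vlineP [q ->] ->]].
by exists p, q.
Qed.

Lemma quadratic_point (y : K) : y ^+ 2 = x * (x ^+ 2 + 1) * (x ^+ 2 + 2 * x - 1) ->
  x ^+ 2 + 1 = 0 \/ x ^+ 2 + 2 * x - 1 = 0.
Proof.
move=> e.
have [p [q ey]] := quadratic_coordinates y.
have [b' [c' ex]] := quadratic_coordinates (x ^+ 2).
pose i := GRing.in_alg K.
have ie a : a%:A = i a by [].
have iz a z : a *: z = i a * z by rewrite /i -scalerAl mul1r.
move: ey ex; rewrite !iz !mulr1 => ey ex.
pose b := - b'; pose c := - c'.
have {}ex : x ^+ 2 + i b * x + i c = 0 by rewrite ex /b /c; ring.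
pose A := 2 * (p * q) -
  (b ^+ 4 - 3 * b ^+ 2 * c + c ^+ 2 - 2 * b ^+ 3 + 4 * b * c - 2 * b - 1 + b * p ^+ 2).
pose B := q ^+ 2 -
  (b ^+ 3 * c - 2 * b * c ^+ 2 - 2 * b ^+ 2 * c + 2 * c ^+ 2 - 2 * c + c * p ^+ 2).
(* Division with remainder of [(p x + q)^2] minus the quintic by [x^2 + b x + c]: the last factor is
   the quotient, [A x + B] the remainder. *)
have eAB : i A * x + i B = 0.
  transitivity (y ^+ 2 - x * (x ^+ 2 + 1) * (x ^+ 2 + 2 * x - 1) - (x ^+ 2 + i b * x + i c) *
   (i p ^+ 2 - (x ^+ 3 + (2 - i b) * x ^+ 2 + (i b ^+ 2 - i c - 2 * i b) * x
     + (- i b ^+ 3 + 2 * i b * i c + 2 * i b ^+ 2 - 2 * i c + 2)))).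
    by rewrite ey /A /B; ring.
  by rewrite e ex subrr mul0r subrr.
have [A0 B0] : A = 0 /\ B = 0.
  by apply: quadratic_independent; rewrite iz ie.
have rat_in a : x <> i a by move=> xa; case/negP: hx; rewrite xa memvZ // mem1v.
have E1 := subr0_eq A0; have E0 := subr0_eq B0.
case: (rational_quadratic_relation E1 E0) => [[b0 c1]|[b2 c1]|[b0 c1]|[[b4 c1]|c0]].
- by left; rewrite -ex b0 c1; ring.
- by right; rewrite -ex b2 c1; ring.
- have /eqP : (x - i 1) * (x - i (-1)) = 0 by rewrite -ex b0 c1; ring.
  by rewrite mulf_eq0 !subr_eq0 => /orP [] /eqP /rat_in.
- have : (2 * x + i b) ^+ 2 = 0.
    transitivity (4 * (x ^+ 2 + i b * x + i c) + (i (b ^+ 2) - 4)); first by rewrite c1; ring.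
    by rewrite ex b4; ring.
  move/eqP; rewrite expf_eq0 /= => /eqP h; case: (rat_in (- b / 2)).
  apply: (@mulfI _ (i 2)); first by rewrite fmorph_eq0.
  have -> : i 2 * i (- b / 2) = i (- b) by rewrite -rmorphM; congr (i _); rewrite mulrC divfK.
  by apply/eqP; rewrite -subr_eq0 -h; apply/eqP; ring.
- have /eqP : x * (x - i (- b)) = 0 by rewrite -ex c0; ring.
  by rewrite mulf_eq0 subr_eq0 => /orP [] /eqP; [rewrite -[RHS](rmorph0 i) |] => /rat_in.
Qed.

End Quadratic.

(** * Weierstrass equations *)

Section ChangeOfVariables.
Variables (F : fieldType) (u r s t : F).
Hypothesis u0 : u != 0.

Definition wchange (E : wcoeffs F) : wcoeffs F :=
  WCoeffs ((a1 E + 2 * s) / u)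
    ((a2 E - s * a1 E + 3 * r - s ^+ 2) / u ^+ 2)
    ((a3 E + r * a1 E + 2 * t) / u ^+ 3)
    ((a4 E - s * a3 E + 2 * r * a2 E - (t + r * s) * a1 E + 3 * r ^+ 2 - 2 * s * t) / u ^+ 4)
    ((a6 E + r * a4 E + r ^+ 2 * a2 E + r ^+ 3 - t * a3 E - t ^+ 2 - r * t * a1 E) / u ^+ 6).

Definition wpoint_change (P : wpoint F) : wpoint F :=
  if P is Some (x, y) then Some ((x - r) / u ^+ 2, (y - s * (x - r) - t) / u ^+ 3) else None.

Lemma wiso_wchange E : wiso E (wchange E).
Proof.
exists u, r, s, t; split=> //; rewrite /wchange /=.
by do 4 (split; first by rewrite mulrC divfK ?expf_neq0); rewrite mulrC divfK ?expf_neq0.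
Qed.

Lemma on_curve_wchange E P : on_curve E P -> on_curve (wchange E) (wpoint_change P).
Proof.
case: P => [[x y]|] //= /eqP e; rewrite -subr_eq0; apply/eqP.
transitivity ((y ^+ 2 + a1 E * x * y + a3 E * y
    - (x ^+ 3 + a2 E * x ^+ 2 + a4 E * x + a6 E)) / u ^+ 6).
  by field.
by rewrite e subrr mul0r.
Qed.

(** The two equations differ by [(y1 - y2) (y1 + y2 + a1 x + a3)]. The tangent branch of [wadd]
    reads only the first point, so the equality of both has to be supplied. *)
Lemma on_curve_same_x (E : wcoeffs F) x y1 y2 :
  on_curve E (Some (x, y1)) -> on_curve E (Some (x, y2)) ->
  y1 + y2 + a1 E * x + a3 E != 0 -> y1 = y2.
Proof.
move=> /eqP e1 /eqP e2 ne; apply/eqP; rewrite -subr_eq0; apply/eqP/(mulIf ne).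
rewrite mul0r; transitivity ((y1 ^+ 2 + a1 E * x * y1 + a3 E * y1)
  - (y2 ^+ 2 + a1 E * x * y2 + a3 E * y2)).
  by ring.
by rewrite e1 e2 subrr.
Qed.

Lemma wadd_wchange E P Q : on_curve E P -> on_curve E Q ->
  wadd (wchange E) (wpoint_change P) (wpoint_change Q) = wpoint_change (wadd E P Q).
Proof.
case: P Q => [[x1 y1]|] [[x2 y2]|] // cP cQ /=.
have ex : ((x1 - r) / u ^+ 2 == (x2 - r) / u ^+ 2) = (x1 == x2).
  by rewrite (eqtype.inj_eq (mulIf _)) ?invr_eq0 ?expf_neq0 // (eqtype.inj_eq (addIr _)).
rewrite ex; have [ex1|nx] := eqVneq x1 x2 => /=; last first.
  have d0 : x2 - x1 != 0 by rewrite subr_eq0 eq_sym.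
  by congr (Some (_, _)); field; rewrite u0 d0.
rewrite -{}ex1 in cQ ex *.
have -> : ((y1 - s * (x1 - r) - t) / u ^+ 3 + (y2 - s * (x1 - r) - t) / u ^+ 3 +
   (a1 E + 2 * s) / u * ((x1 - r) / u ^+ 2) + (a3 E + r * a1 E + 2 * t) / u ^+ 3) =
   (y1 + y2 + a1 E * x1 + a3 E) / u ^+ 3 by field.
rewrite mulf_eq0 invr_eq0 (negPf (expf_neq0 3 u0)) orbF.
case: eqVneq => //= ny; have ey := on_curve_same_x cP cQ ny.
have d0 : 2 * y1 + a1 E * x1 + a3 E != 0 by move: ny; rewrite -ey mulr2n mulrDl mul1r.
have -> : 2 * ((y1 - s * (x1 - r) - t) / u ^+ 3) + (a1 E + 2 * s) / u * ((x1 - r) / u ^+ 2)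
  + (a3 E + r * a1 E + 2 * t) / u ^+ 3 = (2 * y1 + a1 E * x1 + a3 E) / u ^+ 3 by field.
by congr (Some (_, _)); field; rewrite u0 d0.
Qed.

End ChangeOfVariables.

Section GroupLaw.
Variable F : fieldType.
Implicit Types (E : wcoeffs F) (P Q : wpoint F).

(* The value at [x] of the cubic cut out on the curve by the line y = l x + m. *)
Definition line_cubic E (l m x : F) : F :=
  x ^+ 3 + a2 E * x ^+ 2 + a4 E * x + a6 E
  - ((l * x + m) ^+ 2 + a1 E * x * (l * x + m) + a3 E * (l * x + m)).

Lemma line_cubic_third E l m x : line_cubic E l m x = 0 ->
  on_curve E (Some (x, - (l + a1 E) * x - m - a3 E)).
Proof.
by move=> e; rewrite /= -subr_eq0 -[X in _ == X]oppr0 -e /line_cubic; apply/eqP; ring.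
Qed.

(** Vieta: the roots of [line_cubic] add up to [l^2 + a1 l - a2], and [x1], [x2] are roots, or [x1]
    a double root for a tangent. *)
Lemma on_curve_wadd E P Q : on_curve E P -> on_curve E Q -> on_curve E (wadd E P Q).
Proof.
case: P Q => [[x1 y1]|] [[x2 y2]|] // cP cQ /=.
have cubic l m x y : y = l * x + m -> on_curve E (Some (x, y)) -> line_cubic E l m x = 0.
  by move=> e /= /eqP c; rewrite /line_cubic -c -e subrr.
have [ex|nx] := eqVneq x1 x2 => /=; last first.
  have d0 : x2 - x1 != 0 by rewrite subr_eq0 eq_sym.
  set l := (y2 - y1) / _; set m := (_ - _ * _) / _; apply: line_cubic_third.
  have c1 : line_cubic E l m x1 = 0 by apply: cubic cP; rewrite /l /m; field.
  have c2 : line_cubic E l m x2 = 0 by apply: cubic cQ; rewrite /l /m; field.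
  apply: (mulfI d0); rewrite mulr0.
  set x3 := l ^+ 2 + _ - _ - _ - _.
  transitivity (line_cubic E l m x2 * (x3 - x1) - line_cubic E l m x1 * (x3 - x2)).
    by rewrite /line_cubic /x3; ring.
  by rewrite c1 c2 !mul0r subrr.
rewrite -{}ex in cQ *; case: eqVneq => //= ny; have ey := on_curve_same_x cP cQ ny.
have d0 : 2 * y1 + a1 E * x1 + a3 E != 0 by move: ny; rewrite -ey mulr2n mulrDl mul1r.
set l := (_ - a1 E * y1) / _; set m := (_ - a3 E * y1) / _; apply: line_cubic_third.
have em : y1 = l * x1 + m.
  have -> : l * x1 + m = y1 - 2 * (y1 ^+ 2 + a1 E * x1 * y1 + a3 E * y1
    - (x1 ^+ 3 + a2 E * x1 ^+ 2 + a4 E * x1 + a6 E)) / (2 * y1 + a1 E * x1 + a3 E).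
    by rewrite /l /m; field.
  by move: cP => /eqP ->; rewrite subrr mulr0 mul0r subr0.
have c1 : line_cubic E l m x1 = 0 by apply: cubic cP.
have dl : 3 * x1 ^+ 2 + 2 * a2 E * x1 + a4 E - a1 E * y1 - l * (2 * y1 + a1 E * x1 + a3 E) = 0.
  by rewrite /l divfK // subrr.
set x3 := l ^+ 2 + _ - _ - _ - _.
transitivity (line_cubic E l m x1 + (3 * x1 ^+ 2 + 2 * a2 E * x1 + a4 E - a1 E * y1
  - l * (2 * y1 + a1 E * x1 + a3 E)) * (x3 - x1)).
  have -> : m = y1 - l * x1 by rewrite {1}em addrC addKr.
  by rewrite /line_cubic /x3; ring.
by rewrite c1 dl mul0r addr0.
Qed.

Lemma on_curve_wmul E n P : on_curve E P -> on_curve E (wmul E n P).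
Proof. by move=> cP; elim: n => //= n IH; apply: on_curve_wadd. Qed.

Lemma wmul_wchange u r s t E n P : u != 0 -> on_curve E P ->
  wmul (wchange u r s t E) n (wpoint_change u r s t P) = wpoint_change u r s t (wmul E n P).
Proof.
move=> u0 cP; elim: n => //= n IH.
by rewrite -/(wmul _ _ _) IH wadd_wchange // on_curve_wmul.
Qed.

Lemma has_order_wchange u r s t E n P : u != 0 -> on_curve E P -> has_order E P n ->
  has_order (wchange u r s t E) (wpoint_change u r s t P) n.
Proof.
move=> u0 cP [h1 h2]; split; first by rewrite wmul_wchange // h1.
by move=> m hm; rewrite wmul_wchange //; case: (wmul E m P) (h2 m hm) => [[]|].
Qed.

Lemma wisoP E E' : wiso E E' -> exists u r s t, u != 0 /\ E' = wchange u r s t E.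
Proof.
case: E' => b1 b2 b3 b4 b6 [u [r [s [t [u0 [h1 [h2 [h3 [h4 h6]]]]]]]]].
exists u, r, s, t; split=> //; rewrite /wchange -h1 -h2 -h3 -h4 -h6 /=.
by congr WCoeffs; rewrite mulrC mulKf ?expf_neq0.
Qed.

Lemma wiso_sym E E' : wiso E E' -> wiso E' E.
Proof.
move=> /wisoP [u [r [s [t [u0 ->]]]]].
exists u^-1, (- r / u ^+ 2), (- s / u), ((r * s - t) / u ^+ 3).
by split; [rewrite invr_eq0 | rewrite /wchange /=; do 4 (split; first by field); field].
Qed.

Lemma wiso_trans E E' E'' : wiso E E' -> wiso E' E'' -> wiso E E''.
Proof.
move=> /wisoP [u [r [s [t [u0 ->]]]]] /wisoP [u' [r' [s' [t' [u'0 ->]]]]].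
exists (u * u'), (r + u ^+ 2 * r'), (s + u * s'), (t + u ^+ 3 * t' + u ^+ 2 * s * r').
split; first exact: mulf_neq0.
by rewrite /wchange /=; do 4 (split; first by field; rewrite ?u0 ?u'0); field; rewrite ?u0 ?u'0.
Qed.

Lemma elliptic_wiso E E' : wiso E E' -> elliptic E -> elliptic E'.
Proof.
move=> /wisoP [u [r [s [t [u0 ->]]]]]; rewrite /elliptic => d0.
have : u ^+ 12 * wdisc (wchange u r s t E) = wdisc E.
  by rewrite /wdisc /wb2 /wb4 /wb6 /wb8 /wchange /=; field.
by move=> e; move: d0; rewrite -e mulf_eq0 negb_or => /andP [].
Qed.

End GroupLaw.

(** * Tate's normal form *)

Section TateForm.
Variable F : fieldType.
Implicit Types (E : wcoeffs F) (P Q : wpoint F).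

Definition tate (b c : F) : wcoeffs F := WCoeffs (1 - c) (- b) (- b) 0 0.
Definition origin : wpoint F := Some (0, 0).

Lemma wpoint_change_origin u s x y : wpoint_change u x s y (Some (x, y)) = origin.
Proof. by rewrite /wpoint_change /origin !subrr mulr0 subr0 subrr !mul0r. Qed.

Lemma wmul1 E P : wmul E 1 P = P.
Proof. by case: P => [[]|]. Qed.

Lemma wmul2 E P : wmul E 2 P = wadd E P P.
Proof. by rewrite /wmul /= -/(wmul E 1 P); case: P => [[]|]. Qed.

Lemma wmulS E P n : wmul E n.+1 P = wadd E P (wmul E n P).
Proof. by []. Qed.

(** The tangent at the origin is [y = 0]. If [A3 = 0] the origin has order 2; if [A2 = 0] it is a
    flex, of order 3. *)
Lemma normal_form_nonzero A1 A2 A3 :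
  (forall m, (0 < m < 4)%N -> wmul (WCoeffs A1 A2 A3 0 0) m origin <> None) ->
  A2 != 0 /\ A3 != 0.
Proof.
move=> h; have h2 := h 2%N isT; have h3 := h 3%N isT.
have A30 : A3 != 0.
  by apply/eqP => e; apply: h2; rewrite wmul2 /= e !mulr0 !addr0 !eqxx.
split=> //; apply/eqP => e; apply: h3; rewrite wmulS wmul2 /= e.
rewrite !mulr0 !addr0 !add0r eqxx (negPf A30) /=.
by rewrite !(mulr0, mul0r, subr0, expr0n, oppr0, addr0, add0r, subrr, eqxx) /= ?addNr ?eqxx.
Qed.

Lemma exists_tate E P n : (3 < n)%N -> on_curve E P -> has_order E P n ->
  exists b c, [/\ wiso E (tate b c), b != 0 & has_order (tate b c) origin n].
Proof.
move=> n4 cP oP; have [_ hP] := oP.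
case: P cP oP hP => [[x y]|] cP oP hP; last first.
  by case: (hP 1%N); [case: n n4 {oP hP} => [|[]] | rewrite wmul1].
have lt_n m : (m < 4)%N -> (m < n)%N by move=> /leq_trans; apply.
have d0 : a3 E + x * a1 E + 2 * y != 0.
  apply/eqP => e; apply: (hP 2%N); first by rewrite lt_n.
  rewrite wmul2 /= eqxx /=.
  have -> : y + y + a1 E * x + a3 E = a3 E + x * a1 E + 2 * y by ring.
  by rewrite e eqxx.
(* The slope of the tangent at the point: making the tangent horizontal removes [a4]. Scaling by
   [A3 / A2] below then makes [a2] and [a3] equal. *)
pose s := (a4 E + 2 * x * a2 E - y * a1 E + 3 * x ^+ 2) / (a3 E + x * a1 E + 2 * y).
pose E1 := wchange 1 x s y E.
have [A1 [A2 [A3 eE1]]] : exists A1 A2 A3, E1 = WCoeffs A1 A2 A3 0 0.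
  exists (a1 E1), (a2 E1), (a3 E1); rewrite /E1 /wchange /=; congr WCoeffs.
    by rewrite /s; field; rewrite oner_neq0 d0.
  move: cP => /= /eqP cP; rewrite expr1n divr1; apply/eqP; rewrite -[X in _ == X]oppr0.
  rewrite -(subrr (y ^+ 2 + a1 E * x * y + a3 E * y)) {2}cP; apply/eqP; ring.
have o1 : has_order E1 origin n.
  have := has_order_wchange x s y (oner_neq0 F) cP oP.
  by rewrite wpoint_change_origin.
have i1 : wiso E E1 by apply: wiso_wchange; apply: oner_neq0.
have c1 : on_curve E1 origin by rewrite eE1 /= !(expr0n, mulr0, mul0r, addr0).
have [A20 A30] : A2 != 0 /\ A3 != 0.
  apply: (@normal_form_nonzero A1) => m /andP [m0 m4]; rewrite -eE1.
  by have [_ h] := o1; apply: h; rewrite m0 lt_n.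
have u0 : A3 / A2 != 0 by rewrite mulf_neq0 ?invr_eq0.
exists (- A2 / (A3 / A2) ^+ 2), (1 - A1 / (A3 / A2)).
have e2 : tate (- A2 / (A3 / A2) ^+ 2) (1 - A1 / (A3 / A2)) = wchange (A3 / A2) 0 0 0 E1.
  by rewrite eE1 /tate /wchange /=; congr WCoeffs; field; rewrite A20 A30.
split.
- by rewrite e2; apply: (wiso_trans i1); exact: wiso_wchange.
- by rewrite mulf_neq0 ?oppr_eq0 // invr_eq0 expf_neq0.
- rewrite e2; have := has_order_wchange 0 0 0 u0 c1 o1.
  by rewrite wpoint_change_origin.
Qed.

Definition tate_neg (b c : F) (Q : wpoint F) : wpoint F :=
  if Q is Some (x, y) then Some (x, b - (1 - c) * x - y) else None.

Lemma tate_add_origin (b c x y : F) : x != 0 ->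
  wadd (tate b c) origin (Some (x, y)) =
  Some ((y / x) ^+ 2 + (1 - c) * (y / x) + b - x,
        b - (y / x + 1 - c) * ((y / x) ^+ 2 + (1 - c) * (y / x) + b - x)).
Proof.
move=> x0; rewrite /= eq_sym (negPf x0) /= !subr0 mul0r mulr0 subrr mul0r.
by congr (Some (_, _)); field.
Qed.

Lemma tate_add_neg_origin b c : wadd (tate b c) origin (Some (0, b)) = None.
Proof. by rewrite /= eqxx mulr0 add0r addr0 subrr eqxx. Qed.

Lemma tate_double_origin (b c : F) : b != 0 -> wadd (tate b c) origin origin = Some (b, b * c).
Proof.
move=> b0; rewrite /= eqxx !(mulr0, add0r) oppr_eq0 (negPf b0) /=.
by congr (Some (_, _)); field; rewrite oppr_eq0.
Qed.

(* Together with [n P = 0] this gives [- (n - m) P = m P] without the associativity law. *)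
Lemma tate_cancel (b c : F) Q : b != 0 -> on_curve (tate b c) Q ->
  wadd (tate b c) origin (tate_neg b c (wadd (tate b c) origin Q)) = tate_neg b c Q.
Proof.
move=> b0; case: Q => [[x y]|]; last first.
  move=> _; have -> : tate_neg b c (wadd (tate b c) origin None) = Some (0, b).
    by rewrite /= mulr0 !subr0.
  exact: tate_add_neg_origin.
have [-> cQ|x0 cQ] := eqVneq x 0.
  have /eqP : y * (y - b) = 0.
    transitivity (y ^+ 2 + (1 - c) * 0 * y + - b * y
      - (0 ^+ 3 + - b * 0 ^+ 2 + 0 * 0 + 0)); first ring.
    by move: cQ => /= /eqP ->; rewrite subrr.
  rewrite mulf_eq0 subr_eq0 => /orP [] /eqP ->.
    rewrite -[Some (0, 0)]/origin tate_double_origin // /tate_neg tate_add_origin //.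
    have -> : b - (1 - c) * b - b * c = 0 by ring.
    by congr (Some (_, _)); field.
  by rewrite tate_add_neg_origin; congr (Some (_, _)); ring.
rewrite tate_add_origin //; set l := y / x; set x3 := _ - x.
rewrite /tate_neg.
have ey : y = l * x by rewrite /l divfK.
have -> : b - (1 - c) * x3 - (b - (l + 1 - c) * x3) = l * x3 by ring.
have [x30|x30] := eqVneq x3 0.
  have l0 : l = 0.
    apply: (mulIf b0); rewrite mul0r.
    move: cQ => /= /eqP; rewrite ey => cQ; apply: (mulfI x0); rewrite mulr0.
    transitivity ((x ^+ 3 + - b * x ^+ 2 + 0 * x + 0
      - ((l * x) ^+ 2 + (1 - c) * x * (l * x) + - b * (l * x))) + x ^+ 2 * x3).
      by rewrite /x3; ring.
    by rewrite cQ subrr x30 mulr0 addr0.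
  have ex : x = b by apply/eqP; rewrite eq_sym -subr_eq0 -x30 /x3 l0; apply/eqP; ring.
  rewrite x30 mulr0 -[Some (0, 0)]/origin tate_double_origin // ey l0 ex.
  by congr (Some (_, _)); ring.
rewrite tate_add_origin //; have -> : l * x3 / x3 = l by rewrite mulfK.
by congr (Some (_, _)); rewrite ?ey /x3; ring.
Qed.

Lemma tate_symmetric (b c : F) n m : b != 0 -> wmul (tate b c) n origin = None -> (m <= n)%N ->
  tate_neg b c (wmul (tate b c) (n - m) origin) = wmul (tate b c) m origin.
Proof.
move=> b0 on; elim: m => [|m IH] hm; first by rewrite subn0 on.
have c0 : on_curve (tate b c) origin by rewrite /= !(expr0n, mulr0, mul0r, addr0).
rewrite wmulS -(IH (ltnW hm)) -(subnSK hm) wmulS tate_cancel //.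
exact: on_curve_wmul.
Qed.

End TateForm.
Arguments origin {F}.

Section TateMultiples.
Variable F : fieldType.

Lemma wadd_double (E : wcoeffs F) (x y : F) : 2 * y + a1 E * x + a3 E != 0 ->
  let l := (3 * x ^+ 2 + 2 * a2 E * x + a4 E - a1 E * y) / (2 * y + a1 E * x + a3 E) in
  let m := (- x ^+ 3 + a4 E * x + 2 * a6 E - a3 E * y) / (2 * y + a1 E * x + a3 E) in
  let x3 := l ^+ 2 + a1 E * l - a2 E - x - x in
  wadd E (Some (x, y)) (Some (x, y)) = Some (x3, - (l + a1 E) * x3 - m - a3 E).
Proof.
move=> d0 l m x3; rewrite /= eqxx /=.
have -> : y + y + a1 E * x + a3 E = 2 * y + a1 E * x + a3 E by ring.
by rewrite (negPf d0).
Qed.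

(* The parameters are [b = r s (r - 1)], [c = s (r - 1)]. *)
Lemma tate_doublings (b c : F) : b != 0 -> has_order (tate b c) origin 16 ->
  exists P2 P4 x8 y8, let E := tate b c in
  [/\ wadd E origin origin = Some P2, wadd E (Some P2) (Some P2) = Some P4,
      wadd E (Some P4) (Some P4) = Some (x8, y8) & 2 * y8 + (1 - c) * x8 - b = 0].
Proof.
move=> b0 [o16 ho]; set E := tate b c.
(* If the abscissa of [m P] vanished, [m P] would be [(0, b) = - P] and [(m + 1) P] would be zero.
   Each use yields one non-vanishing factor. *)
have next m x y : (m.+1 < 16)%N -> wmul E m origin = Some (x, y) -> (x = 0 -> y = b) -> x != 0.
  move=> m16 em xy; apply/eqP => x0; apply: (ho m.+1) => //.
  by rewrite wmulS -/E em x0 xy // tate_add_neg_origin.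
have e2 : wmul E 2 origin = Some (b, b * c) by rewrite wmul2 tate_double_origin.
have e3 : wmul E 3 origin = Some (c, b - c).
  by rewrite wmulS e2 tate_add_origin //; congr (Some (_, _)); field.
have c0 : c != 0 by apply: next e3 _ => // ->; rewrite subr0.
have [r er] : exists r, b = r * c by exists (b / c); rewrite divfK.
have r0 : r != 0 by move: b0; rewrite er mulf_eq0 negb_or => /andP [].
have e4 : wmul E 4 origin = Some (r * (r - 1), r ^+ 2 * (c - r + 1)).
  by rewrite wmulS e3 tate_add_origin // er; congr (Some (_, _)); field.
have r1 : r - 1 != 0.
  have : r * (r - 1) != 0.
    apply: next e4 _ => //; move/eqP; rewrite mulf_eq0 (negPf r0) subr_eq0 /= => /eqP r1.
    by rewrite er r1; ring.
  by rewrite mulf_eq0 negb_or => /andP [].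
have [s es] : exists s, c = s * (r - 1) by exists (c / (r - 1)); rewrite divfK.
have s0 : s != 0 by move: c0; rewrite es mulf_eq0 negb_or => /andP [].
have e5 : wmul E 5 origin = Some (r * s * (s - 1), r * s ^+ 2 * (r - s)).
  rewrite wmulS e4 tate_add_origin ?mulf_neq0 //; subst b c.
  by congr (Some (_, _)); field; rewrite r1 r0.
have s1 : s - 1 != 0.
  have : r * s * (s - 1) != 0.
    apply: next e5 _ => //; move/eqP.
    rewrite !mulf_eq0 (negPf r0) (negPf s0) subr_eq0 /= => /eqP s1.
    by rewrite er es s1; ring.
  by rewrite mulf_eq0 negb_or => /andP [].
have e6 : wmul E 6 origin = Some (s * (r - 1) * (r - s) / (s - 1) ^+ 2,
    s ^+ 2 * (r - 1) ^+ 2 * (r * s - 2 * r + 1) / (s - 1) ^+ 3).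
  rewrite wmulS e5 tate_add_origin ?mulf_neq0 //; subst b c.
  by congr (Some (_, _)); field; rewrite s1 s0 r0.
have rs : r - s != 0.
  have : s * (r - 1) * (r - s) / (s - 1) ^+ 2 != 0.
    apply: next e6 _ => //; move/eqP.
    rewrite !mulf_eq0 invr_eq0 expf_eq0 /= (negPf r1) (negPf s0) (negPf s1) orbF.
    rewrite subr_eq0 /= => /eqP rs.
    by rewrite er es rs; rewrite rs in r1; field.
  by rewrite !mulf_eq0 !negb_or => /andP [/andP [_ ->]].
pose w := r * s - 2 * r + 1.
pose l7 := s * (r - 1) * w / ((s - 1) * (r - s)).
have e7 : wmul E 7 origin = Some (r * s * (r - 1) * (s - 1) * w / (r - s) ^+ 2,
    b - (l7 + 1 - c) * (r * s * (r - 1) * (s - 1) * w / (r - s) ^+ 2)).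
  rewrite wmulS e6 tate_add_origin; last by rewrite !mulf_neq0 ?invr_eq0 ?expf_neq0.
  rewrite /l7 /w; subst b c; congr (Some (_, _)); field; by rewrite ?r1 ?s1 ?s0 ?rs.
have w0 : w != 0.
  have : r * s * (r - 1) * (s - 1) * w / (r - s) ^+ 2 != 0.
    by apply: next e7 _ => // ->; rewrite mulr0 subr0.
  by rewrite !mulf_eq0 !negb_or => /andP [/andP [_ ->]].
(* [wmul] adds [P] repeatedly; that doubling reaches the same [4 P] and [8 P] is checked on
   coordinates. *)
have e24 : wadd E (Some (b, b * c)) (Some (b, b * c)) =
    Some (r * (r - 1), r ^+ 2 * (c - r + 1)).
  have d0 : 2 * (b * c) + (1 - c) * b + - b != 0.
    have -> : 2 * (b * c) + (1 - c) * b + - b = b * c by ring.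
    by rewrite mulf_neq0.
  rewrite wadd_double //=; move: d0; rewrite er => d0.
  by congr (Some (_, _)); field.
have x70 : r * s * (r - 1) * (s - 1) * w / (r - s) ^+ 2 != 0.
  by rewrite !mulf_neq0 ?invr_eq0 ?expf_neq0.
have := tate_add_origin b c
  (b - (l7 + 1 - c) * (r * s * (r - 1) * (s - 1) * w / (r - s) ^+ 2)) x70.
rewrite -/E -e7 -wmulS; set x8 := _ - _ / (r - s) ^+ 2; set y8 := b - _ => e8.
exists (b, b * c), (r * (r - 1), r ^+ 2 * (c - r + 1)), x8, y8; split.
- exact: tate_double_origin.
- exact: e24.
- have d0 : 2 * (r ^+ 2 * (c - r + 1)) + (1 - c) * (r * (r - 1)) + - b != 0.
    have -> : 2 * (r ^+ 2 * (c - r + 1)) + (1 - c) * (r * (r - 1)) + - b = r * (r - 1) * w.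
      by rewrite /w er es; ring.
    by rewrite !mulf_neq0.
  rewrite wadd_double //=; move: d0; rewrite /y8 /x8 /l7 /w.
  clear - r0 r1 s0 s1 rs w0 er es => d0.
  subst b; subst c; rewrite /w in w0.
  by congr (Some (_, _)); field; rewrite ?rs ?w0 ?s0 ?s1 ?r0 ?r1.
- have := tate_symmetric (m := 8) b0 o16 isT; rewrite -/E e8 => -[e].
  by transitivity (y8 - (b - (1 - c) * x8 - y8)); [ring | rewrite e subrr].
Qed.
End TateMultiples.

(** * Halving the point of order 2 *)

Section ShortForm.
Variable F : fieldType.
Hypothesis two0 : 2 != 0 :> F.

Definition short (A B : F) : wcoeffs F := WCoeffs 0 A 0 B 0.

Lemma short_elliptic A B : elliptic (short A B) -> B != 0 /\ A ^+ 2 - 4 * B != 0.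
Proof.
rewrite /elliptic; have -> : wdisc (short A B) = 16 * (B ^+ 2 * (A ^+ 2 - 4 * B)).
  by rewrite /wdisc /wb2 /wb4 /wb6 /wb8 /=; ring.
by move=> h; split; apply: contraNneq h => e; rewrite e ?expr0n ?mul0r !mulr0.
Qed.

Lemma short_double A B (x y x' y' : F) : on_curve (short A B) (Some (x, y)) ->
  wadd (short A B) (Some (x, y)) (Some (x, y)) = Some (x', y') ->
  [/\ y != 0, y ^+ 2 = x ^+ 3 + A * x ^+ 2 + B * x, 4 * y ^+ 2 * x' = (x ^+ 2 - B) ^+ 2 &
   let l := (3 * x ^+ 2 + 2 * A * x + B) / (2 * y) in
   x' = l ^+ 2 - A - 2 * x /\ y' = - l * x' - (- x ^+ 3 + B * x) / (2 * y)].
Proof.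
move=> c e.
have ec : y ^+ 2 = x ^+ 3 + A * x ^+ 2 + B * x.
  transitivity (y ^+ 2 + 0 * x * y + 0 * y); first ring.
  by move: c => /= /eqP ->; ring.
have y0 : y != 0.
  apply/eqP => y0; move: e; rewrite /= y0 !(mul0r, addr0) !eqxx /=; discriminate.
have d0 : 2 * y + 0 * x + 0 != 0 by rewrite mul0r !addr0 mulf_neq0.
move: e; rewrite (wadd_double (E := short A B)) //= => -[].
have -> : 2 * y + 0 * x + 0 = 2 * y by ring.
move=> ex ey.
have ex' : x' = ((3 * x ^+ 2 + 2 * A * x + B) / (2 * y)) ^+ 2 - A - 2 * x.
  by rewrite -ex; field; rewrite two0 y0.
split=> //.
  rewrite ex'; apply/eqP; rewrite -subr_eq0; apply/eqP.
  transitivity (4 * (A + 2 * x) * ((x ^+ 3 + A * x ^+ 2 + B * x) - y ^+ 2)).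
    by field; rewrite two0 y0.
  by rewrite ec subrr mulr0.
split=> //; rewrite -ey ex ex'; by field; rewrite two0 y0.
Qed.

Lemma square_eq_or (a b : F) : a ^+ 2 = b ^+ 2 -> a = b \/ a = - b.
Proof. by move/eqP; rewrite eqf_sqr => /orP [] /eqP; [left | right]. Qed.

(* Let [m] be the slope of the tangent at [P2], which meets the curve again at [- P4], and
   [mu] that of the line from [(0, 0)] to [P4].  Then [x(P2) = g dl^2] for [dl = - m - mu], and
   [x(P2)] is a square because [P2 = 2 P1]; hence [g = h^2]. *)
Lemma short_halving A B P1 P2 P4 : elliptic (short A B) ->
  on_curve (short A B) (Some P1) -> on_curve (short A B) (Some P2) ->
  on_curve (short A B) (Some P4) ->
  wadd (short A B) (Some P1) (Some P1) = Some P2 ->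
  wadd (short A B) (Some P2) (Some P2) = Some P4 ->
  wadd (short A B) (Some P4) (Some P4) = Some (0, 0) ->
  exists h w v : F, [/\ v != 0, A = v ^+ 2 * ((h ^+ 2 - 1) ^+ 4 - 8 * h ^+ 4),
    B = v ^+ 4 * (16 * h ^+ 8) & w ^+ 2 = (h ^+ 2 - 1) * (h ^+ 2 + 1) * (h ^+ 2 + 2 * h - 1)].
Proof.
move=> ell; have [B0 D0] := short_elliptic ell.
case: P1 P2 P4 => [x1 y1] [x2 y2] [x4 y4] c1 c2 c4 e1 e2 e4.
have [y10 f1 g1 [_ _]] := short_double c1 e1.
have [y20 f2 g2] := short_double c2 e2; set m := _ / _ => -[ex4 ey4].
have [y40 f4 g4 _] := short_double c4 e4.
have eB : B = x4 ^+ 2.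
  by move: g4; rewrite mulr0 => /esym/eqP; rewrite expf_eq0 subr_eq0 => /andP [_ /eqP].
have x40 : x4 != 0 by move: B0; rewrite eB expf_eq0.
have nz x y : y != 0 -> y ^+ 2 = x ^+ 3 + A * x ^+ 2 + B * x -> x != 0.
  by move=> y0 e; apply: contraNneq y0 => x0; rewrite -sqrf_eq0 e x0 !expr0n /= !mulr0 !addr0.
have x10 := nz _ _ y10 f1; have x20 := nz _ _ y20 f2.
set n := (- x2 ^+ 3 + B * x2) / (2 * y2) in ey4.
have enm : y2 = m * x2 + n.
  have -> : m * x2 + n = (x2 ^+ 3 + A * x2 ^+ 2 + B * x2) / y2.
    by rewrite /m /n; field; rewrite two0 y20.
  by rewrite -f2 expr2 mulfK.
have en2 : n ^+ 2 = x2 ^+ 2 * x4.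
  rewrite ex4; apply/eqP; rewrite -subr_eq0; apply/eqP.
  transitivity (y2 * (n - m * x2) + A * x2 ^+ 2 + 2 * x2 ^+ 3); first by rewrite {1}enm; ring.
  by rewrite /n /m; field; rewrite two0 y20.
have n0 : n != 0 by rewrite -sqrf_eq0 en2 mulf_neq0 // expf_neq0.
pose dl := n / x4; have dl0 : dl != 0 by rewrite mulf_neq0 // invr_eq0.
pose mu := y4 / x4.
have emu : mu ^+ 2 = A + 2 * x4.
  by rewrite /mu expr_div_n f4 eB; field.
pose g := x2 / dl ^+ 2.
have ex2 : x2 = g * dl ^+ 2 by rewrite /g divfK // expf_neq0.
have eg4 : x4 = g ^+ 2 * dl ^+ 2.
  apply: (mulfI (expf_neq0 2 dl0)); transitivity (x2 ^+ 2); last by rewrite ex2; ring.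
  by rewrite /dl expr_div_n en2; field.
have emm : m = - dl - mu by rewrite /dl /mu ey4; field.
have emu2 : mu = - dl * (g - 1) ^+ 2 / 2.
  have h1 : 2 * x2 = x4 + m ^+ 2 - mu ^+ 2 by rewrite emu ex4; ring.
  apply: (mulfI two0); apply: (mulfI dl0).
  transitivity (m ^+ 2 - mu ^+ 2 - dl ^+ 2); first by rewrite emm; ring.
  transitivity (2 * x2 - x4 - dl ^+ 2); first by rewrite h1; ring.
  by rewrite ex2 eg4; field.
have eA : A = (dl / 2) ^+ 2 * ((g - 1) ^+ 4 - 8 * g ^+ 2).
  have -> : A = mu ^+ 2 - 2 * x4 by rewrite emu; ring.
  by rewrite emu2 eg4; field.
have eB' : B = (dl / 2) ^+ 4 * (16 * g ^+ 4).
  by rewrite eB eg4; field.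
have ey2 : y2 ^+ 2 = (g * dl ^+ 3 * (g ^+ 2 - 1) / 2) ^+ 2.
  by rewrite f2 ex2 eA eB'; field.
pose ka := (x1 ^+ 2 - B) / (2 * y1).
have eka : ka ^+ 2 = x2.
  by rewrite /ka expr_div_n -g1; field; rewrite two0 y10.
have ka0 : ka != 0 by rewrite -sqrf_eq0 eka.
pose eta := y1 / x1.
(* With [z = x1 + B / x1 = eta^2 - A] one has [z^2 - 4 B = (x1 - B / x1)^2 = 4 ka^2 (A + z)]; this
   completes the square in [z]. *)
have eeta : (eta ^+ 2 - A - 2 * ka ^+ 2) ^+ 2 = 4 * (y2 / ka) ^+ 2.
  have -> : (y2 / ka) ^+ 2 = ka ^+ 4 + A * ka ^+ 2 + B.
    by rewrite expr_div_n f2 -eka; field.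
  have eta2 : eta ^+ 2 = A + (x1 + B / x1) by rewrite /eta expr_div_n f1; field.
  have ke : 4 * (ka ^+ 2 * eta ^+ 2) = (x1 - B / x1) ^+ 2.
    rewrite -exprMn; have -> : ka * eta = (x1 - B / x1) / 2.
      by rewrite /ka /eta; field; rewrite two0 y10 x10.
    by field; rewrite two0 x10.
  rewrite eta2 in ke *; apply/eqP; rewrite -subr_eq0; apply/eqP.
  transitivity ((x1 - B / x1) ^+ 2 - 4 * (ka ^+ 2 * (A + (x1 + B / x1)))); first by field.
  by rewrite ke subrr.
pose h0 := ka / dl.
have eh0 : h0 ^+ 2 = g by rewrite /h0 expr_div_n eka.
have g0 : g != 0 by move: x20; rewrite ex2 mulf_eq0 negb_or => /andP [].
have g1' : g != 1.
  apply: contraNneq D0 => e; rewrite eA eB' e; apply/eqP; ring.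
have [h [eh eeta']] : exists h, h ^+ 2 = g /\
    eta ^+ 2 = A + 2 * (g * dl ^+ 2) + h * dl ^+ 2 * (h ^+ 4 - 1).
  have : (eta ^+ 2 - A - 2 * ka ^+ 2) ^+ 2 = (h0 * dl ^+ 2 * (h0 ^+ 4 - 1)) ^+ 2.
    rewrite eeta expr_div_n ey2 eka ex2 -eh0; field.
    by rewrite two0 dl0 -sqrf_eq0 eh0 g0.
  rewrite eka ex2 => /square_eq_or [e|e]; [exists h0 | exists (- h0)]; split=> //.
  - by rewrite -e; ring.
  - by rewrite sqrrN.
  - by rewrite mulNr mulNr exprNn -signr_odd expr0 mul1r -e; ring.
have h1 : h - 1 != 0.
  by rewrite subr_eq0; apply: contraNneq g1' => e; rewrite -eh e expr1n.
(* [4 eta^2 / dl^2] is the required product times [(h - 1)^2], which the denominator of [w]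
   absorbs. *)
exists h, (2 * eta / (dl * (h - 1))), (dl / 2); split.
- by rewrite mulf_neq0 // invr_eq0.
- by rewrite eA -eh; ring.
- by rewrite eB' -eh; ring.
- rewrite expr_div_n exprMn eeta' eA -eh; field.
  by rewrite two0 dl0 h1.
Qed.

End ShortForm.

Definition x1_16_coeffs (F : fieldType) (h : F) : wcoeffs F :=
  short ((h ^+ 2 - 1) ^+ 4 - 8 * h ^+ 4) (16 * h ^+ 8).

Lemma x1_16_param (F : fieldType) (E : wcoeffs F) : 2 != 0 :> F -> elliptic E ->
  has_cyclic_subgroup E 16 ->
  exists h w : F, wiso E (x1_16_coeffs h) /\
    w ^+ 2 = (h ^+ 2 - 1) * (h ^+ 2 + 1) * (h ^+ 2 + 2 * h - 1).
Proof.
move=> two0 ell [P [cP oP]].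
have [b [c [iso b0 o16]]] := exists_tate (n := 16) isT cP oP.
have [P2 [P4 [x8 [y8 [d1 d2 d4 sym]]]]] := tate_doublings b0 o16.
set T := tate b c in iso o16 d1 d2 d4.
have c1 : on_curve T origin by rewrite /= !(expr0n, mulr0, mul0r, addr0).
have c2 : on_curve T (Some P2) by rewrite -d1 on_curve_wadd.
have c4 : on_curve T (Some P4) by rewrite -d2 on_curve_wadd.
have c8 : on_curve T (Some (x8, y8)) by rewrite -d4 on_curve_wadd.
(* This removes [a1]. Then [a3] vanishes because [8 P] has a vertical tangent ([sym]), and [a6]
   because [8 P] lies on the curve. *)
pose s := - (1 - c) / 2.
pose A := a2 (wchange 1 x8 s y8 T); pose B := a4 (wchange 1 x8 s y8 T).
have eS : wchange 1 x8 s y8 T = short A B.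
  rewrite /A /B /short /wchange /=; congr WCoeffs.
  - by rewrite /s; field; rewrite two0 oner_neq0.
  - by rewrite expr1n divr1 -sym; ring.
  - move: c8 => /= /eqP c8; rewrite expr1n divr1; apply/eqP; rewrite -oppr_eq0; apply/eqP.
    transitivity (y8 ^+ 2 + (1 - c) * x8 * y8 + - b * y8
      - (x8 ^+ 3 + - b * x8 ^+ 2 + 0 * x8 + 0)).
      by ring.
    by rewrite c8 subrr.
have u1 := oner_neq0 F.
have isoS : wiso E (short A B) by rewrite -eS; apply: (wiso_trans iso); apply: wiso_wchange.
have tr Q Q' : on_curve T Q -> wadd T Q Q = Q' ->
    wadd (short A B) (wpoint_change 1 x8 s y8 Q) (wpoint_change 1 x8 s y8 Q) =
    wpoint_change 1 x8 s y8 Q'.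
  by move=> cQ <-; rewrite -eS wadd_wchange.
have ctr Q : on_curve T Q -> on_curve (short A B) (wpoint_change 1 x8 s y8 Q).
  by move=> cQ; rewrite -eS; apply: on_curve_wchange.
have ellS : elliptic (short A B) by apply: elliptic_wiso isoS ell.
have e8 := tr _ _ c4 d4; rewrite wpoint_change_origin in e8.
case: P2 P4 d1 d2 d4 c2 c4 e8 => [x2 y2] [x4 y4] d1 d2 d4 c2 c4 e8.
have [h [w [v [v0 eA eB ew]]]] := short_halving two0 ellS (ctr _ c1) (ctr _ c2) (ctr _ c4)
  (tr _ _ c1 d1) (tr _ _ c2 d2) e8.
exists h, w; split=> //; apply: (wiso_trans isoS).
have -> : x1_16_coeffs h = wchange v 0 0 0 (short A B).
  by rewrite /x1_16_coeffs /short /wchange /= eA eB; congr WCoeffs; field.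
exact: wiso_wchange.
Qed.

Lemma x1_16_elliptic (F : fieldType) (h : F) : elliptic (x1_16_coeffs h) ->
  [/\ h ^+ 2 + 1 != 0, h ^+ 2 + 2 * h - 1 != 0 & h + 1 != 0].
Proof.
case/short_elliptic => _.
have -> : ((h ^+ 2 - 1) ^+ 4 - 8 * h ^+ 4) ^+ 2 - 4 * (16 * h ^+ 8) =
  (h ^+ 2 + 1) * ((h ^+ 2 + 2 * h - 1) * ((h + 1) * ((h + 1) ^+ 3 * (h - 1) ^+ 4 * (h ^+ 2 + 1) *
  (h ^+ 2 - 2 * h - 1)))) by ring.
by rewrite !mulf_eq0 !negb_or => /andP [-> /andP [-> /andP [-> _]]].
Qed.

Lemma wdisc_base_change (K : fieldExtType rat) (E : wcoeffs rat) :
  wdisc (wbase_change K E) = (wdisc E)%:A.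
Proof.
have ie (q : rat) : q%:A = GRing.in_alg K q by [].
case: E => b1 b2 b3 b4 b6; rewrite /wdisc /wb2 /wb4 /wb6 /wb8 /wbase_change /= !ie; ring.
Qed.

(* K ranges over quadratic number fields: field extensions of Q of degree 2. *)
Theorem theorem1 (K : fieldExtType rat) (hK : \dim {: K} = 2%N)
  (E : wcoeffs K) (hE : elliptic E) (h16 : has_cyclic_subgroup E 16) :
  exists E0 : wcoeffs rat, elliptic E0 /\ wiso (wbase_change K E0) E.
Proof.
have two0 : 2 != 0 :> K by rewrite -(rmorph_nat (GRing.in_alg K)) fmorph_eq0.
have [h [w [iso ew]]] := x1_16_param two0 hE h16.
have ell := elliptic_wiso iso hE.
have [n1 n2 n3] := x1_16_elliptic ell.
pose i := GRing.in_alg K.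
have [/vlineP [q eq]|hQ] := boolP (h \in 1%VS).
  have eh : h = i q by [].
  have eb : wbase_change K (x1_16_coeffs q) = x1_16_coeffs h.
    rewrite /wbase_change /x1_16_coeffs /short /= eh -!/(i _).
    by congr WCoeffs; rewrite -?[_%:A]/(i _); ring.
  exists (x1_16_coeffs q); split; last by rewrite eb; apply: wiso_sym.
  by move: ell; rewrite /elliptic -eb wdisc_base_change scaler_eq0 oner_eq0 orbF.
pose x := (1 - h) / (1 + h).
have h1 : 1 + h != 0 by rewrite addrC.
have ex1 : 1 + x = 2 / (1 + h) by rewrite /x; field.
have x1 : 1 + x != 0 by rewrite ex1 mulf_neq0 // invr_eq0.
have eh : h = (1 - x) / (1 + x) by rewrite ex1 /x; field; rewrite two0 h1.
have xQ : x \notin 1%VS.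
  apply: contra hQ => /vlineP [q eq]; apply/vlineP; exists ((1 - q) / (1 + q)).
  have ex : x = i q by [].
  have e : GRing.in_alg K ((1 - q) / (1 + q)) =
      (1 - GRing.in_alg K q) / (1 + GRing.in_alg K q).
    by rewrite fmorph_div rmorphB rmorphD rmorph1.
  by rewrite eh ex; exact: esym e.
(* Under [h = (1 - x) / (1 + x)] the three factors become [-4 x], [2 (x^2 + 1)] and
   [-2 (x^2 + 2 x - 1)] over [(1 + x)^2]. *)
have ey : (w * (1 + x) ^+ 3 / 4) ^+ 2 = x * (x ^+ 2 + 1) * (x ^+ 2 + 2 * x - 1).
  rewrite expr_div_n exprMn ew eh; field; rewrite x1 andbT.
  by rewrite -(rmorph_nat (GRing.in_alg K)) fmorph_eq0.
case: (quadratic_point hK xQ ey) => e; exfalso.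
- move/eqP: n1; apply; apply: (mulIf (expf_neq0 2 x1)).
  by rewrite mul0r; transitivity (2 * (x ^+ 2 + 1)); [rewrite eh; field | rewrite e mulr0].
- move/eqP: n2; apply; apply: (mulIf (expf_neq0 2 x1)).
  rewrite mul0r; transitivity (- 2 * (x ^+ 2 + 2 * x - 1)); last by rewrite e mulr0.
  by rewrite eh; field.
Qed.
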